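(* Suppose $f$ has a unique global maximum point $\mu$, of type $k$ and strength $\lambda$. Then, as $N\to\infty$, under $P_N$ the random variable $\bar S_k(\sigma)=\dfrac{S_N(\sigma)-N\mu}{N^{1-1/(2k)}}$ converges in distribution to: - the centered Gaussian law with variance $(-\lambda)^{-1}-J^{-1}$ if $k=1$, and moreover $(-\lambda)^{-1}-J^{-1}>0$ in this case; - the probability law with density proportional to $\exp\big(\frac{\lambda}{(2k)!}x^{2k}\big)$ if $k>1$.
   Context: Let $\rho$ be a non-degenerate Borel probability measure on $\mathbb{R}$ such that $\int_{\mathbb{R}}\exp\big(\tfrac{a x^2}{2}+bx\big)\,d\rho(x)<\infty$ for all $a>0$, $b\in\mathbb{R}$. Fix $J>0$ and $h\in\mathbb{R}$. For $N\ge1$ and $\sigma=(\sigma_1,\dots,\sigma_N)\in\mathbb{R}^N$ let $H_N(\sigma)=-\frac{J}{2N}\sum_{i,j=1}^N\sigma_i\sigma_j-h\sum_{i=1}^N\sigma_i$, and let $P_N$ be the probability measure on $\mathbb{R}^N$ given by $dP_N(\sigma)=Z_N^{-1}\exp(-H_N(\sigma))\prod_{i=1}^N d\rho(\sigma_i)$, where $Z_N$ is the normalizing constant. Let $S_N(\sigma)=\sum_{i=1}^N\sigma_i$ and $m_N(\sigma)=S_N(\sigma)/N$. Define $f(x)=-\frac{J}{2}x^2+\ln\int_{\mathbb{R}}\exp\big(s(Jx+h)\big)\,d\rho(s)$. For a global maximum point $\mu$ of $f$, its type is the positive integer $k$ and its strength is the negative real $\lambda$ such that $f^{(j)}(\mu)=0$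 for $1\le j\le 2k-1$ and $f^{(2k)}(\mu)=\lambda<0$. *)

(* Defs.v *)
From HB Require Import structures.
From mathcomp Require Import all_boot all_order all_algebra.
From mathcomp Require Import all_classical all_reals all_analysis.
Set Implicit Arguments. Unset Strict Implicit. Unset Printing Implicit Defensive.
Import Order.TTheory GRing.Theory Num.Theory.
Import numFieldNormedType.Exports.
Local Open Scope classical_set_scope.
Local Open Scope ring_scope.

(* configurations sigma in R^N are represented as functions nat -> R,
   of which only the first N coordinates sigma 0, ..., sigma (N-1) matter *)
Definition scons {R : realType} (x : R) (s : nat -> R) : nat -> R :=
  fun i => if i is i'.+1 then s i' else x.

Fixpoint prod_int {R : realType} (rho : probability R R) (n : nat)
    (F : (nat -> R) -> R) : R :=
  match n with
  | 0 => F (fun _ => 0)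
  | n'.+1 => Rintegral rho setT
               (fun x => prod_int rho n' (fun s => F (scons x s)))
  end.

Definition S_N {R : realType} (N : nat) (sigma : nat -> R) : R :=
  \sum_(i < N) sigma i.

Definition H_N {R : realType} (J h : R) (N : nat) (sigma : nat -> R) : R :=
  - (J / (2 * N%:R)) * (\sum_(i < N) \sum_(j < N) sigma i * sigma j)
  - h * (\sum_(i < N) sigma i).

Definition Z_N {R : realType} (rho : probability R R) (J h : R) (N : nat) : R :=
  prod_int rho N (fun sigma => expR (- H_N J h N sigma)).

Definition E_PN {R : realType} (rho : probability R R) (J h : R) (N : nat)
    (F : (nat -> R) -> R) : R :=
  prod_int rho N (fun sigma => F sigma * expR (- H_N J h N sigma))
  / Z_N rho J h N.

Definition f_CW {R : realType} (rho : probability R R) (J h : R) (x : R) : R :=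
  - (J / 2) * x ^+ 2 + ln (Rintegral rho setT (fun s => expR (s * (J * x + h)))).

Definition Sbar {R : realType} (mu : R) (k N : nat) (sigma : nat -> R) : R :=
  (S_N N sigma - N%:R * mu) / (N%:R `^ (1 - (k.*2)%:R^-1)).

(* Main.v *)
Require Import Defs.
From HB Require Import structures.
From mathcomp Require Import all_boot all_order all_algebra.
From mathcomp Require Import all_classical all_reals all_analysis.
From mathcomp Require Import measurable_realfun ring lra.
Import Order.TTheory GRing.Theory Num.Theory.
Import numFieldNormedType.Exports.
Local Open Scope classical_set_scope.
Local Open Scope ring_scope.

(** By the Hubbard-Stratonovich identity, adding to [Sbar] an independent centered Gaussian of
    precision [a = J N / r^2], where [r^(2k) = N], gives a variable with density proportional to
    [exp (N (f (mu + x / r) - f mu))].  By Taylor's formula at [mu] this converges to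
    [exp (lambda x^(2k) / (2k)!)], and it is dominated by a Gaussian uniformly in [N], so all
    integrals against quadratically growing functions converge.  The Gaussian convolution
    multiplies trigonometric moments by the nonzero number [gauss_chf a t], which tends to 1 when
    [k > 1] and is constant when [k = 1]; hence the trigonometric moments of [Sbar] converge, and
    its second moments are bounded.  Approximating a bounded continuous function on a large
    interval by trigonometric polynomials (Bernstein polynomials in [(1 + sin (w x)) / 2]) gives
    convergence in distribution. *)

(** * Continuity and measurability *)

(** The explicit characteristic function of a Gaussian is never computed. Two evaluations of one
    double integral show that [gauss_chf] turns addition of variances into multiplication; with the
    bound [1 - 8 t^2 / a <= gauss_chf a t] this yields non-vanishing and the limit 1 for growing
    precision. Non-vanishing is essential, since the smoothing is undone by division. The dichotomy
    in [k] comes from [r^2 = N^(1/k)]: the precision [J N^(1 - 1/k)] equals [J] when [k = 1], so a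
    variance [1/J] has to be removed from [1/(-lambda)], and it diverges when [k > 1]. The uniform
    Gaussian majorant needs global information on [f]: near [mu] only decay of order [u^(2k)] is
    available, far out only quadratic decay, and both survive the scaling because [r >= 1]. Since
    the Hamiltonian depends on a configuration only through its sum, the iterated integrals over R^N
    reduce to one law on R. Tonelli exchanges are applied to nonnegative functions, with [1 + cos]
    in place of [cos]; the constant part is subtracted afterwards. *)

Section continuous_functions.
Context {R : realType}.
Implicit Types f g : R -> R.

Lemma continuous_cstE (c : R) : continuous (fun _ : R => c).
Proof. by move=> x; exact: cvg_cst. Qed.

Lemma continuous_idE : continuous (fun x : R => x).
Proof. by move=> x; exact: cvg_id. Qed.

Lemma continuous_addE f g :
  continuous f -> continuous g -> continuous (fun x => f x + g x).
Proof. by move=> cf cg x; apply: cvgD; [exact: cf|exact: cg]. Qed.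

Lemma continuous_oppE f : continuous f -> continuous (fun x => - f x).
Proof. by move=> cf x; apply: cvgN; exact: cf. Qed.

Lemma continuous_mulE f g :
  continuous f -> continuous g -> continuous (fun x => f x * g x).
Proof. by move=> cf cg x; apply: cvgM; [exact: cf|exact: cg]. Qed.

Lemma continuous_expE f n : continuous f -> continuous (fun x => f x ^+ n).
Proof.
move=> cf; elim: n => [|n IH].
  by under eq_fun do rewrite expr0; exact: continuous_cstE.
by under eq_fun do rewrite exprS; exact: continuous_mulE.
Qed.

Lemma continuous_compE f g :
  continuous g -> continuous f -> continuous (fun x => g (f x)).
Proof. by move=> cg cf x; apply: continuous_comp; [exact: cf|exact: cg]. Qed.

Lemma continuous_maxE f g :
  continuous f -> continuous g -> continuous (fun x => Num.max (f x) (g x)).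
Proof. by move=> cf cg x; apply: continuous_max; [exact: cf|exact: cg]. Qed.

Lemma continuous_minE f g :
  continuous f -> continuous g -> continuous (fun x => Num.min (f x) (g x)).
Proof. by move=> cf cg x; apply: continuous_min; [exact: cf|exact: cg]. Qed.

Lemma continuous_expRE f : continuous f -> continuous (fun x => expR (f x)).
Proof. by apply: continuous_compE; exact: continuous_expR. Qed.

Lemma continuous_cosE f : continuous f -> continuous (fun x => cos (f x)).
Proof. by apply: continuous_compE; exact: continuous_cos. Qed.

End continuous_functions.

(** Descends along the syntax of the function, which is why the lemmas above state closure for
    explicit pointwise lambdas. Subtraction and division by a constant are covered, being notations
    for addition of an opposite and multiplication by an inverse. *)
Ltac continuity := repeat lazymatch goal with
  | |- continuous (fun x => @?f x + @?g x) => apply: (continuous_addE f g)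
  | |- continuous (fun x => - @?f x) => apply: (continuous_oppE f)
  | |- continuous (fun x => @?f x * @?g x) => apply: (continuous_mulE f g)
  | |- continuous (fun x => @?f x ^+ ?n) => apply: (continuous_expE f n)
  | |- continuous (fun x => Num.max (@?f x) (@?g x)) => apply: (continuous_maxE f g)
  | |- continuous (fun x => Num.min (@?f x) (@?g x)) => apply: (continuous_minE f g)
  | |- continuous (fun x => expR (@?f x)) => apply: (continuous_expRE f)
  | |- continuous (fun x => cos (@?f x)) => apply: (continuous_cosE f)
  | |- continuous (fun x => x) => apply: continuous_idE
  | |- continuous (fun _ => ?c) => apply: (continuous_cstE c)
  | |- _ => assumption
  end.

Section measurable_functions.
Context {R : realType} {d : measure_display} {T : measurableType d}.
Implicit Types f g : T -> R.

Lemma measurable_addE f g : measurable_fun setT f -> measurable_fun setT g ->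
  measurable_fun setT (fun x => f x + g x).
Proof. exact: measurable_funD. Qed.

Lemma measurable_oppE f : measurable_fun setT f ->
  measurable_fun setT (fun x => - f x).
Proof. exact: measurable_funN. Qed.

Lemma measurable_mulE f g : measurable_fun setT f -> measurable_fun setT g ->
  measurable_fun setT (fun x => f x * g x).
Proof. exact: measurable_funM. Qed.

Lemma measurable_expE f n : measurable_fun setT f ->
  measurable_fun setT (fun x => f x ^+ n).
Proof. exact: measurable_funX. Qed.

Lemma measurable_compE (g : R -> R) f : continuous g -> measurable_fun setT f ->
  measurable_fun setT (fun x => g (f x)).
Proof.
by move=> cg mf; apply: measurableT_comp mf; exact: continuous_measurable_fun.
Qed.

Lemma measurable_expRE f : measurable_fun setT f ->
  measurable_fun setT (fun x => expR (f x)).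
Proof. by apply: measurable_compE; exact: continuous_expR. Qed.

Lemma measurable_cosE f : measurable_fun setT f ->
  measurable_fun setT (fun x => cos (f x)).
Proof. by apply: measurable_compE; exact: continuous_cos. Qed.

End measurable_functions.

Ltac measurability := repeat lazymatch goal with
  | |- measurable_fun _ (fun x => @?f x + @?g x) => apply: (measurable_addE f g)
  | |- measurable_fun _ (fun x => - @?f x) => apply: (measurable_oppE f)
  | |- measurable_fun _ (fun x => @?f x * @?g x) => apply: (measurable_mulE f g)
  | |- measurable_fun _ (fun x => @?f x ^+ ?n) => apply: (measurable_expE f n)
  | |- measurable_fun _ (fun x => expR (@?f x)) => apply: (measurable_expRE f)
  | |- measurable_fun _ (fun x => cos (@?f x)) => apply: (measurable_cosE f)
  | |- measurable_fun _ (fun x => x.1) => exact: measurable_fst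
  | |- measurable_fun _ (fun x => x.2) => exact: measurable_snd
  | |- measurable_fun _ (fun x => x) => exact: measurable_id
  | |- measurable_fun _ (fun _ => ?c) => exact: measurable_cst
  | |- _ => assumption
  end.


Lemma is_derive_continuous {R : realType} (f df : R -> R) :
  (forall x : R, is_derive x 1 f (df x)) -> continuous f.
Proof.
by move=> fdf x; apply/differentiable_continuous/derivable1_diffP; apply: ex_derive.
Qed.

Lemma MVT_is_derive {R : realType} (f df : R -> R) (a b : R) : a < b ->
  (forall x : R, is_derive x 1 f (df x)) ->
  exists2 c, a < c < b & f b - f a = df c * (b - a).
Proof.
move=> ab fdf; have cf := is_derive_continuous f df fdf.
have [c] := @MVT R f df a b ab (fun x _ => fdf x) (continuous_subspaceT cf).
by rewrite in_itv/= => cab E; exists c.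
Qed.

Section ge0_integral_EFin.
Context {R : realType} {d : measure_display} {T : measurableType d} (m : {measure set T -> \bar R}).
Implicit Types f g : T -> R.

Lemma ge0_integralZE f c : measurable_fun setT f -> (forall x, 0 <= f x) ->
  0 <= c -> (\int[m]_x (c * f x)%:E = c%:E * \int[m]_x (f x)%:E)%E.
Proof.
move=> mf f0 c0; under eq_integral do rewrite EFinM.
rewrite ge0_integralZl//; first exact/measurable_EFinP.
by move=> x _; rewrite lee_fin.
Qed.

Lemma ge0_integralDE f g : measurable_fun setT f -> (forall x, 0 <= f x) ->
  measurable_fun setT g -> (forall x, 0 <= g x) ->
  (\int[m]_x (f x + g x)%:E = \int[m]_x (f x)%:E + \int[m]_x (g x)%:E)%E.
Proof.
move=> mf f0 mg g0; under eq_integral do rewrite EFinD.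
rewrite ge0_integralD//.
- by move=> x _; rewrite lee_fin.
- exact/measurable_EFinP.
- by move=> x _; rewrite lee_fin.
- exact/measurable_EFinP.
Qed.

Lemma ge0_le_integralE f g : measurable_fun setT f -> (forall x, 0 <= f x) ->
  measurable_fun setT g -> (forall x, f x <= g x) ->
  (\int[m]_x (f x)%:E <= \int[m]_x (g x)%:E)%E.
Proof.
move=> mf f0 mg fg; apply: ge0_le_integral => //.
- by move=> x _; rewrite lee_fin.
- exact/measurable_EFinP.
- exact/measurable_EFinP.
- by move=> x _; rewrite lee_fin.
Qed.

End ge0_integral_EFin.

(** * Trigonometric approximation *)

(** The Bernstein polynomial with values [G i] at the nodes, that is, the mean of [G] at a binomial
    variable of parameters [n], [y], written by conditioning on one trial. Monotonicity and moments
    then follow by direct induction. *)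
Fixpoint bernstein {R : realType} (n : nat) (G : nat -> R) (y : R) : R :=
  if n is m.+1 then
    y * bernstein m (fun i => G i.+1) y + (1 - y) * bernstein m G y
  else G 0%N.

Lemma bernstein_le {R : realType} (n : nat) (G H : nat -> R) (y : R) :
  0 <= y <= 1 -> (forall i, (i <= n)%N -> G i <= H i) ->
  bernstein n G y <= bernstein n H y.
Proof.
move=> /andP[y0 y1]; elim: n G H => [|n IH] G H GH /=; first exact: GH.
apply: lerD; apply: ler_wpM2l; rewrite ?subr_ge0//; apply: IH => i ni.
  exact: GH.
by apply: GH; rewrite (leq_trans ni).
Qed.

(** Second moment of a binomial variable about [c]: variance plus squared bias. The centre must stay
    free, since a success in one trial moves it to [c - 1]. *)
Lemma bernstein_sqr {R : realType} (n : nat) (A B c y : R) :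
  bernstein n (fun i => A + B * (i%:R - c) ^+ 2) y =
  A + B * (n%:R * (y * (1 - y)) + (n%:R * y - c) ^+ 2).
Proof.
elim: n c => [|n IH] c /=; first by ring.
rewrite IH (_ : (fun i : nat => _) =
  (fun i : nat => A + B * (i%:R - (c - 1)) ^+ 2)); last first.
  by apply/funext => i; rewrite -natr1; ring.
by rewrite IH -natr1; ring.
Qed.

(** Chebyshev's argument: [G] is squeezed between two parabolas with vertex at the binomial mean
    [n y], where the bias vanishes and only the variance is left. *)
Lemma bernstein_approx {R : realType} (n : nat) (G : nat -> R) (v A B y : R) :
  0 <= y <= 1 ->
  (forall i, (i <= n)%N -> `|G i - v| <= A + B * (i%:R - n%:R * y) ^+ 2) ->
  `|bernstein n G y - v| <= A + B * (n%:R * (y * (1 - y))).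
Proof.
move=> y01 H.
have up : bernstein n G y <=
    bernstein n (fun i => (v + A) + B * (i%:R - n%:R * y) ^+ 2) y.
  by apply: bernstein_le => // i /H; rewrite ler_distl => /andP[_]; lra.
have lo : bernstein n (fun i => (v - A) + (- B) * (i%:R - n%:R * y) ^+ 2) y <=
    bernstein n G y.
  by apply: bernstein_le => // i /H; rewrite ler_distl => /andP[]; lra.
rewrite !bernstein_sqr subrr expr0n/= addr0 in up lo.
by rewrite ler_distl; apply/andP; split; lra.
Qed.


(** Uniform continuity covers [|z - y| < d]; at larger distance the oscillation is at most
    [2 M <= (2 M / d^2) (z - y)^2]. The error has the shape that [bernstein_approx] consumes. *)
Lemma heine_sqr {R : realType} (G : R -> R) (M a b e : R) :
  continuous G -> (forall x, `|G x| <= M) -> 0 < e ->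
  exists2 C : R, 0 <= C & forall y z, a <= y <= b ->
    `|G z - G y| <= e + C * (z - y) ^+ 2.
Proof.
move=> cG HM e0.
have M0 : 0 <= M by apply: le_trans (HM 0).
have H : \forall d \near (0:R)^'+, `[a, b] `<=`
   (fun y => forall z, `|z - y| < d -> `|G z - G y| <= e).
  apply: ((compact_near_coveringP _).1 (@segment_compact R a b)).
  move=> y yab.
  have /cvgrPdist_lt /(_ (e / 2)) := cG y.
  rewrite divr_gt0// => /(_ erefl) /nbhs_ballP[d /= d0 Hd].
  exists (ball y (d / 2), [set x | x < d / 2]) => /=.
    split; first by apply: nbhsx_ballx; rewrite divr_gt0.
    by apply: nbhs_right_lt; rewrite divr_gt0.
  move=> [y' d'] /= [+ dd'] z zy'; rewrite /ball/= => yy'.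
  have h1 := Hd y' _; have h2 := Hd z _.
  have {}h1 : `|G y - G y'| < e / 2.
    by apply: h1; rewrite /ball_/=; apply: lt_trans yy' _; rewrite ltr_pdivrMr// ltr_pMr// ltr1n.
  have {}h2 : `|G y - G z| < e / 2.
    apply: h2; suff : `|y - z| < d by [].
    rewrite (_ : y - z = (y - y') - (z - y')); last by ring.
    by apply: le_lt_trans (ler_normB _ _) _; lra.
  rewrite (_ : G z - G y' = (G y - G y') - (G y - G z)); last by ring.
  by apply: le_trans (ler_normB _ _) _; lra.
have [d [Hd d0]] := filter_ex (filterI H (@nbhs_right_gt R 0)).
exists (2 * M / d ^+ 2); first by rewrite divr_ge0 ?sqr_ge0 ?mulr_ge0.
move=> y z yab; have [zy|zy] := ltP `|z - y| d.
  apply: le_trans (Hd y _ z zy) _; first by rewrite /= in_itv.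
  by rewrite lerDl mulr_ge0 ?divr_ge0 ?sqr_ge0 ?mulr_ge0.
apply: (@le_trans _ _ (2 * M)).
  by apply: le_trans (ler_normB _ _) _; have := HM z; have := HM y; lra.
rewrite -[leLHS]add0r lerD ?(ltW e0)// -mulrA ler_peMr ?mulr_ge0//.
rewrite mulrC ler_pdivlMr ?exprn_gt0// mul1r -(real_normK (num_real (z - y))).
by rewrite lerXn2r ?nnegrE// ltW.
Qed.

(* On [-L, L] the map x |-> y = (1 + sin (x / (2 L))) / 2 is injective, so g is there a
   continuous function of y; outside, the weight x^2 absorbs the error. *)
Lemma trig_approx {R : realType} (g : R -> R) (M e : R) :
  continuous g -> (forall x, `|g x| <= M) -> 0 < e ->
  exists w n (G : nat -> R), forall x,
    `|g x - bernstein n G ((1 + sin (w * x)) / 2)| <= e * (1 + x ^+ 2).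
Proof.
move=> cg HM e0.
have M0 : 0 <= M by apply: le_trans (HM 0).
(* Beyond [|x| = L] the crude error [2 M] is at most [e x^2]; the added 1 makes [L] positive. *)
pose L := Num.sqrt (2 * M / e) + 1.
have L0 : 0 < L by rewrite ltr_wpDl// sqrtr_ge0.
have ML : 2 * M <= e * L ^+ 2.
  rewrite [leRHS]mulrC -ler_pdivrMr// -[leLHS]sqr_sqrtr; last first.
    by rewrite divr_ge0 ?(ltW e0)// mulr_ge0.
  by rewrite lerXn2r ?nnegrE ?sqrtr_ge0 ?(ltW L0)// /L lerDl.
pose s1 : R := sin (2^-1).
have pi2 := @pihalf_ge1 R.
have hin (x : R) : `|x| <= 2^-1 -> x \in `[- (pi / 2), pi / 2].
  by rewrite in_itv/= ler_norml => /andP[]; move: pi2 => *; apply/andP; split; lra.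
have s11 : s1 < 1.
  have h2 : (2^-1 : R) \in `[- (pi / 2), pi / 2] by rewrite hin// ger0_norm.
  have hp : (pi / 2 : R) \in `[- (pi / 2), pi / 2].
    by rewrite in_itv/=; apply/andP; split; lra.
  by rewrite /s1 -[ltRHS](@sin_pihalf R) (ltr_sin h2 hp); lra.
have s10 : 0 <= s1.
  by apply: sin_ge0_pi; apply/andP; split; lra.
(* For [|x| <= L] the angle is at most [1/2], so the sine stays within [s1 = sin (1/2) < 1].
   Clamping there keeps [asin] away from its endpoints: [Ga] is continuous on the whole line and
   still recovers [g x] for [|x| <= L]. *)
pose cl (y : R) := Num.max (- s1) (Num.min s1 (2 * y - 1)).
have clB y : - s1 <= cl y <= s1.
  by rewrite /cl le_max lexx/= ge_max ge_min lexx/= andbT; lra.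
pose Ga y := g (2 * L * asin (cl y)).
have ccl : continuous cl by rewrite /cl; continuity.
have cGa : continuous Ga.
  move=> y; apply: continuous_comp; last exact: cg.
  apply: cvgM; first exact: cvg_cst.
  apply: continuous_comp; first exact: ccl.
  by apply: continuous_asin; have := clB y; lra.
have [C C0 HC] := @heine_sqr R Ga M 0 1 (e / 2) cGa (fun y => HM _) (divr_gt0 e0 (ltr0Sn _ _)).
(* With nodes [i / n] the variance term is [C y (1 - y) / n], which this [n] makes at most
   [e / 2]. *)
pose n := (Num.truncn (2 * C / e)).+1.
have nC : C / n%:R <= e / 2.
  rewrite ler_pdivrMr ?ltr0n//.
  have := ltW (@truncnS_gt R (2 * C / e)); rewrite -/n ler_pdivrMr//; lra.
exists (2 * L)^-1, n, (fun i => Ga (i%:R / n%:R)) => x.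
set y := (1 + _) / 2.
have y01 : 0 <= y <= 1.
  by have := sin_geN1 ((2 * L)^-1 * x); have := sin_le1 ((2 * L)^-1 * x); rewrite /y; lra.
have h1 : `|bernstein n (fun i => Ga (i%:R / n%:R)) y - Ga y| <= e.
  have n0 : n%:R != 0 :> R by rewrite pnatr_eq0.
  apply: le_trans (@bernstein_approx R n _ (Ga y) (e / 2) (C / n%:R ^+ 2) y y01 _) _.
    move=> i ni; apply: le_trans (HC y _ y01) _.
    by rewrite le_eqVlt; apply/orP; left; apply/eqP; field.
  apply: (@le_trans _ _ (e / 2 + C / n%:R * 1)); last by lra.
  rewrite lerD2l (_ : _ * (n%:R * _) = C / n%:R * (y * (1 - y))); last by field.
  by rewrite ler_wpM2l ?divr_ge0//; case/andP: y01 => ? ?; nra.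
have h2 : `|g x - Ga y| <= e * x ^+ 2.
  have [xL|Lx] := leP `|x| L.
    suff -> : g x = Ga y by rewrite subrr normr0 mulr_ge0 ?sqr_ge0// ltW.
    have hx : `|(2 * L)^-1 * x| <= 2^-1.
      rewrite normrM ger0_norm ?invr_ge0 ?mulr_ge0 ?(ltW L0)//.
      by rewrite mulrC ler_pdivrMr ?mulr_gt0//; lra.
    have e1 : cl y = sin ((2 * L)^-1 * x).
      rewrite /cl /y (_ : 2 * _ - 1 = sin ((2 * L)^-1 * x)); last by field.
      move: hx; rewrite ler_norml => /andP[hx1 hx2].
      have hxx : - s1 <= sin ((2 * L)^-1 * x) <= s1.
        have i1 : (2^-1 : R) \in `[- (pi / 2), pi / 2] by rewrite hin// ger0_norm.
        have i2 : (- 2^-1 : R) \in `[- (pi / 2), pi / 2] by rewrite hin// normrN ger0_norm.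
        have i3 : (2 * L)^-1 * x \in `[- (pi / 2), pi / 2] by rewrite hin// ler_norml hx1.
        rewrite /s1 -sinN !leNgt (ltr_sin i3 i2) (ltr_sin i1 i3) -!leNgt hx1 hx2//.
      case/andP: hxx => hx3 hx4.
      by rewrite min_r// max_r.
    rewrite /Ga e1 sinK ?hin//; congr g; field; exact: lt0r_neq0.
  apply: (@le_trans _ _ (2 * M)).
    by apply: le_trans (ler_normB _ _) _; have := HM x; have := HM (2 * L * asin (cl y)); rewrite /Ga; lra.
  apply: le_trans ML _; rewrite ler_wpM2l ?(ltW e0)// -(real_normK (num_real x)).
  by rewrite lerXn2r ?nnegrE ?(ltW L0)// ltW.
rewrite -[X in `|g x - X|](subrK (Ga y)).
rewrite (_ : g x - _ = (g x - Ga y) - (bernstein n (fun i => Ga (i%:R / n%:R)) y - Ga y)); last by ring.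
by apply: le_trans (ler_normB _ _) _; lra.
Qed.

Lemma cos_mul_cos {R : realType} (a b : R) :
  cos a * cos b = (cos (a + b) + cos (a - b)) / 2.
Proof. by rewrite cosD cosB; field. Qed.

(** The predicate [T] is abstract so that convergence of expectations can be substituted for it,
    without expanding the polynomial into a trigonometric sum. *)
Lemma bernstein_trig_ind {R : realType} (T : (R -> R) -> Prop) (w : R) :
  (forall a G H, T G -> T H -> T (fun x => a * G x + H x)) ->
  (forall t c, T (fun x => cos (t * x + c))) ->
  forall n G, T (fun x => bernstein n G ((1 + sin (w * x)) / 2)).
Proof.
move=> Tlin Tcos n G.
(* The cosine factor strengthens the induction: by the product formula, multiplying it by
   [sin (w x)] only shifts its frequency and phase. Frequency and phase 0 give the claim. *)
suff H m F t c : T (fun x => cos (t * x + c) * bernstein m F ((1 + sin (w * x)) / 2)).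
  rewrite (_ : (fun x => _) = (fun x => cos (0 * x + 0) * bernstein n G ((1 + sin (w * x)) / 2))) //.
  by apply/funext => x; rewrite mul0r addr0 cos0 mul1r.
elim: m F t c => [F t c|m IH F t c] /=.
  have T0 : T (fun=> 0).
    have := Tlin (-1) _ _ (Tcos 0 0) (Tcos 0 0).
    by under eq_fun do rewrite mulN1r addNr.
  have := Tlin (F 0%N) _ _ (Tcos t c) T0.
  by under eq_fun do rewrite addr0 mulrC.
(* The values [e = 1] and [e = -1] give the factors [y] and [1 - y] of the recursion; the sine is
   read as [cos (w x - pi / 2)]. *)
have A G0 e : T (fun x => cos (t * x + c) * ((1 + e * sin (w * x)) / 2 * bernstein m G0 ((1 + sin (w * x)) / 2))).
  have T1 := Tlin 2^-1 _ _ (IH G0 t c) (Tlin (e / 4) _ _ (IH G0 (t + w) (c - pi / 2)) (Tlin (-1) _ _ (IH G0 t c) (IH G0 t c))).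
  have := Tlin (e / 4) _ _ (IH G0 (t - w) (c + pi / 2)) T1.
  congr T; apply/funext => x.
  have := cos_mul_cos (t * x + c) (w * x - pi / 2); rewrite cosBpihalf.
  rewrite (_ : t * x + c + (w * x - pi / 2) = (t + w) * x + (c - pi / 2)); last by ring.
  rewrite (_ : t * x + c - (w * x - pi / 2) = (t - w) * x + (c + pi / 2)); last by ring.
  move=> E; rewrite (_ : cos _ * (_ * _) = (cos (t * x + c) + e * (cos (t * x + c) * sin (w * x))) / 2 * bernstein m G0 ((1 + sin (w * x)) / 2)); last by ring.
  by rewrite E; field.
have := Tlin 1 _ _ (A (fun i => F i.+1) 1) (A F (-1)).
congr T; apply/funext => x; set b1 := bernstein _ _ _; set b2 := bernstein _ _ _; by field.
Qed.

(** * Convergence in distribution from trigonometric moments *)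

(** Contains [x^2] besides the bounded continuous functions, so that tightness and convergence are
    expressed by the same functionals. *)
Definition quadratic_growth {R : realType} (G : R -> R) : Prop :=
  continuous G /\ exists C, forall x, `|G x| <= C * (1 + x ^+ 2).

Lemma quadratic_growth_lin {R : realType} (a : R) (G H : R -> R) :
  quadratic_growth G -> quadratic_growth H ->
  quadratic_growth (fun x => a * G x + H x).
Proof.
move=> [cG [C HC]] [cH [D HD]]; split; first by continuity.
exists (`|a| * C + D) => x; apply: le_trans (ler_normD _ _) _.
rewrite normrM mulrDl -mulrA; apply: lerD => //.
by rewrite ler_wpM2l.
Qed.

Lemma quadratic_growth_bounded {R : realType} (G : R -> R) (M : R) :
  continuous G -> (forall x, `|G x| <= M) -> quadratic_growth G.
Proof.
move=> cG HM; split=> //; exists M => x; apply: le_trans (HM x) _.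
have M0 : 0 <= M by apply: le_trans (HM x).
by rewrite ler_peMr// lerDl sqr_ge0.
Qed.

Lemma quadratic_growth_sqr {R : realType} :
  quadratic_growth (fun x : R => x ^+ 2).
Proof.
split; first by continuity.
by exists 1 => x; rewrite mul1r ger0_norm ?sqr_ge0// lerDr.
Qed.

Lemma quadratic_growth_cos {R : realType} (t c : R) :
  quadratic_growth (fun x : R => cos (t * x + c)).
Proof.
apply: (@quadratic_growth_bounded _ _ 1); first by continuity.
by move=> x; rewrite ler_norml cos_geN1 cos_le1.
Qed.

(** Retains only linearity, positivity and normalisation, so that the finite-[N] laws and the limit
    laws are compared without introducing their image measures. *)
Definition expectation {R : realType} (E : (R -> R) -> R) : Prop :=
  [/\ forall a G H, quadratic_growth G -> quadratic_growth H ->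
        E (fun x => a * G x + H x) = a * E G + E H,
      forall G H, quadratic_growth G -> quadratic_growth H ->
        (forall x, G x <= H x) -> E G <= E H &
      E (fun=> 1) = 1].

Lemma expectation_dist {R : realType} (E : (R -> R) -> R) (G H : R -> R) (e : R) :
  expectation E -> quadratic_growth G -> quadratic_growth H ->
  (forall x, `|G x - H x| <= e * (1 + x ^+ 2)) ->
  `|E G - E H| <= e * (1 + E (fun x => x ^+ 2)).
Proof.
move=> [Elin Emon E1] qG qH GH.
have q1 : quadratic_growth (fun=> 1 : R).
  by apply: (@quadratic_growth_bounded _ _ 1) => [|x]; [continuity|rewrite normr1].
have qs : quadratic_growth (fun x : R => 1 * x ^+ 2 + 1).
  by apply: quadratic_growth_lin => //; exact: quadratic_growth_sqr.
have bound F K : quadratic_growth F -> quadratic_growth K ->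
    (forall x, F x <= e * (1 + x ^+ 2) + K x) ->
    E F <= e * (1 + E (fun x => x ^+ 2)) + E K.
  move=> qF qK FK.
  rewrite (_ : e * _ = e * E (fun x : R => 1 * x ^+ 2 + 1)); last first.
    by rewrite Elin ?E1 ?mul1r 1?addrC//; exact: quadratic_growth_sqr.
  rewrite -Elin//; apply: Emon => //; first exact: quadratic_growth_lin.
  by move=> x; apply: le_trans (FK x) _; rewrite mul1r [1 + _]addrC.
rewrite ler_norml; apply/andP; split.
  have := bound _ _ qH qG; have H1 x : H x <= e * (1 + x ^+ 2) + G x.
    by have := GH x; rewrite ler_norml => /andP[]; lra.
  by move=> /(_ H1); lra.
have := bound _ _ qG qH; have H1 x : G x <= e * (1 + x ^+ 2) + H x.
  by have := GH x; rewrite ler_norml => /andP[]; lra.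
by move=> /(_ H1); lra.
Qed.

(* Convergence of all trigonometric moments plus bounded second moments (tightness) is
   convergence in distribution. *)
Lemma expectation_cvg {R : realType} (E_ : nat -> (R -> R) -> R)
    (E : (R -> R) -> R) (K : R) :
  (\forall n \near \oo, expectation (E_ n)) -> expectation E ->
  (\forall n \near \oo, E_ n (fun x => x ^+ 2) <= K) ->
  (forall t c, (fun n => E_ n (fun x => cos (t * x + c))) @ \oo -->
     E (fun x => cos (t * x + c))) ->
  forall (g : R -> R) (M : R), continuous g -> (forall x, `|g x| <= M) ->
  (fun n => E_ n g) @ \oo --> E g.
Proof.
move=> EE_ EE EK Ecos g M cg HM.
pose T G := quadratic_growth G /\ (fun n => E_ n G) @ \oo --> E G.
have Tcos t c : T (fun x => cos (t * x + c)).
  by split; [exact: quadratic_growth_cos|exact: Ecos].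
have Tlin a G H : T G -> T H -> T (fun x => a * G x + H x).
  move=> [qG cG] [qH cH]; split; first exact: quadratic_growth_lin.
  have [Elin _ _] := EE; rewrite Elin//.
  have : (fun n => a * E_ n G + E_ n H) @ \oo --> a * E G + E H.
    by apply: cvgD => //; apply: cvgM => //; exact: cvg_cst.
  apply: cvg_trans; apply: near_eq_cvg.
  by near=> n; have [-> //] : expectation (E_ n); near: n.
have qg := @quadratic_growth_bounded R g M cg HM.
set K' := E (fun x => x ^+ 2).
have q0 : quadratic_growth (fun=> 0 : R).
  by apply: (@quadratic_growth_bounded _ _ 0) => [|x]; [continuity|rewrite normr0].
have E0 (F : (R -> R) -> R) : expectation F -> F (fun=> 0) = 0.
  move=> [L _ _]; have := L (-1) _ _ q0 q0.
  under eq_fun do rewrite mulr0 addr0.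
  by rewrite mulN1r addNr.
have K'0 : 0 <= K'.
  rewrite /K' -(E0 _ EE); have [_ Emon _] := EE.
  by apply: Emon => // [|x]; [exact: quadratic_growth_sqr|exact: sqr_ge0].
have K0 : 0 <= K.
  have [n [En Kn]] := filter_ex (filterI EE_ EK).
  apply: le_trans Kn; rewrite -(E0 _ En); have [_ Emon _] := En.
  by apply: Emon => // [|x]; [exact: quadratic_growth_sqr|exact: sqr_ge0].
apply/cvgrPdist_lt => e e0.
(* The approximation errors under [E] and under [E_ n] then total at most [e / 2]; the other half is
   spent on the trigonometric polynomial. *)
pose d := e / (2 * (2 + K + K')).
have d0 : 0 < d by rewrite divr_gt0// mulr_gt0//; lra.
have [w [m [F HF]]] := @trig_approx R g M d cg HM d0.
set p := fun x => bernstein m F ((1 + sin (w * x)) / 2).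
have [qp cp] : T p by exact: bernstein_trig_ind.
have He : d * (1 + K) + d * (1 + K') = e / 2.
  by rewrite /d; field; apply/eqP; lra.
have h1 := @expectation_dist R E g p d EE qg qp HF.
near=> n.
have En : expectation (E_ n) by near: n.
have Kn : E_ n (fun x => x ^+ 2) <= K by near: n.
have h2 := @expectation_dist R (E_ n) g p d En qg qp HF.
have h3 : `|E p - E_ n p| < e / 2.
  by near: n; move/cvgrPdist_lt : cp; apply; rewrite divr_gt0.
rewrite (_ : E g - E_ n g = (E g - E p) + (E p - E_ n p) - (E_ n g - E_ n p)); last by ring.
apply: le_lt_trans (ler_normB _ _) _; apply: le_lt_trans (lerD (ler_normD _ _) (lexx _)) _.
have h4 : d * (1 + E_ n (fun x => x ^+ 2)) <= d * (1 + K).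
  by rewrite ler_wpM2l ?(ltW d0)// lerD2l.
rewrite -/K' in h1; lra.
Unshelve. all: by end_near. Qed.

(** The law of [X] under [m] reweighted by [w]. It serves the rescaled sum as well as the limit
    laws, where [X] is the identity. *)
Lemma expectation_weighted {R : realType} {d : measure_display}
    {T : measurableType d} (m : {measure set T -> \bar R}) (X w : T -> R) :
  measurable_fun setT X -> measurable_fun setT w -> (forall x, 0 <= w x) ->
  m.-integrable setT (fun x => ((1 + X x ^+ 2) * w x)%:E) ->
  Rintegral m setT w != 0 ->
  expectation (fun G => Rintegral m setT (fun x => G (X x) * w x) /
                        Rintegral m setT w).
Proof.
move=> mX mw w0 iw W0.
have I G : quadratic_growth G -> m.-integrable setT (fun x => (G (X x) * w x)%:E).
  move=> [cG [C HC]].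
  have iC : m.-integrable setT (fun x => (C * ((1 + X x ^+ 2) * w x))%:E).
    rewrite (_ : (fun x => _) = (fun x => (C%:E * ((1 + X x ^+ 2) * w x)%:E)%E)) //.
    exact: integrableZl.
  apply: le_integrable iC => //.
    apply/measurable_EFinP; apply: measurable_funM => //.
    by apply: measurable_compE.
  move=> x _ /=; rewrite lee_fin normrM (ger0_norm (w0 x)) (le_trans _ (ler_norm _))//.
  by rewrite mulrA ler_wpM2r.
split.
- move=> a G H qG qH; rewrite mulrA -mulrDl; congr (_ / _).
  have iaG : m.-integrable setT (fun x => (a * (G (X x) * w x))%:E).
    rewrite (_ : (fun x => _) = (fun x => (a%:E * (G (X x) * w x)%:E)%E)) //.
    by apply: integrableZl => //; exact: I.
  rewrite -RintegralZl//; last exact: I.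
  rewrite -RintegralD//; last exact: I.
  by apply: eq_Rintegral => x _; ring.
- move=> G H qG qH GH; apply: ler_wpM2r; first by rewrite invr_ge0 Rintegral_ge0.
  apply: le_Rintegral => //; [exact: I|exact: I|].
  by move=> x _; rewrite ler_wpM2r.
- by under eq_Rintegral do rewrite mul1r; rewrite divff.
Qed.

(** * Gaussian smoothing *)

(** Translation preserves the lengths of half-open intervals, and these determine Lebesgue
    measure. *)
Lemma integral_translate {R : realType} (f : R -> \bar R) (s : R) :
  measurable_fun setT f -> (forall x, 0 <= f x)%E ->
  (\int[lebesgue_measure]_x f (x + s)%R = \int[lebesgue_measure]_x f x)%E.
Proof.
move=> mf f0.
pose tr (x : measurableTypeR R) : measurableTypeR R := x + s.
have ms : measurable_fun setT tr by apply: measurable_funD.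
transitivity (\int[pushforward lebesgue_measure tr]_x f x)%E.
  by rewrite ge0_integral_pushforward.
apply: eq_measure_integral => A mA _; apply/esym/lebesgue_measure_unique => //.
move=> _ [[a b] _ <-]; rewrite /pushforward.
have E : tr @^-1` `]a, b] = `]a - s, b - s]%classic.
  by apply/seteqP; split => x /=; rewrite /tr !in_itv/= ltrBlDr lerBrDr.
transitivity (lebesgue_measure (tr @^-1` `]a, b])) => //.
rewrite E !lebesgue_measure_itv/= !lte_fin ltrD2r; case: ifP => // _.
by rewrite -!EFinD; congr EFin; ring.
Qed.

Lemma integral_reflect {R : realType} (f : R -> \bar R) :
  measurable_fun setT f -> (forall x, 0 <= f x)%E ->
  (\int[lebesgue_measure]_x f (- x)%R = \int[lebesgue_measure]_x f x)%E.
Proof.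
move=> mf f0.
transitivity (\int[pushforward lebesgue_measure (-%R : _ -> measurableTypeR R)]_x f x)%E.
  by rewrite ge0_integral_pushforward.
by apply: eq_measure_integral => A mA _; exact: lebesgue_measureN.
Qed.

Lemma integral_symmetrize {R : realType} (f : R -> R) :
  measurable_fun setT f -> (forall x, 0 <= f x) ->
  (\int[lebesgue_measure]_x (f x)%:E =
   \int[lebesgue_measure]_x ((f x + f (- x)) / 2)%:E)%E.
Proof.
move=> mf f0.
have mfE : measurable_fun setT (EFin \o f) by apply/measurable_EFinP.
have mfN : measurable_fun setT (fun x : R => f (- x)) by apply: measurableT_comp.
have f0E x : (0 <= (EFin \o f) x)%E by rewrite lee_fin.
have E := integral_reflect (EFin \o f) mfE f0E.
have fN0 x : 0 <= f (- x) by [].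
transitivity (\int[lebesgue_measure]_x (2^-1 * (f x + f (- x)))%:E)%E; last first.
  by apply: eq_integral => x _; rewrite mulrC.
rewrite ge0_integralZE//; last 2 first.
- exact: measurable_addE.
- by move=> x; rewrite addr_ge0.
rewrite ge0_integralDE//.
move: E; rewrite /comp/= => ->; set I := (\int[_]_x _)%E.
by rewrite -mule2n -mule_natl muleA -EFinM mulVf// mul1e.
Qed.

Section gaussian_kernel.
Context {R : realType}.
Implicit Types a b c s t x y : R.

(** The parameter is a precision: this is the unnormalised centered Gaussian density of variance
    [1 / a]. *)
Definition gauss a x := expR (- (a * x ^+ 2 / 2)).

Definition gauss_mass a := Num.sqrt (2 * pi / a).

Lemma gauss_mass_gt0 a : 0 < a -> 0 < gauss_mass a.
Proof. by move=> a0; rewrite sqrtr_gt0 divr_gt0// mulr_gt0// pi_gt0. Qed.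

Lemma continuous_gauss a : continuous (gauss a).
Proof. by rewrite /gauss; continuity. Qed.

Lemma measurable_gauss a : measurable_fun setT (gauss a).
Proof. by apply: continuous_measurable_fun; exact: continuous_gauss. Qed.

Lemma normal_pdf_gauss a x : 0 < a ->
  normal_pdf 0 (Num.sqrt a^-1) x = (gauss_mass a)^-1 * gauss a x.
Proof.
move=> a0; have s0 : Num.sqrt a^-1 != 0 by rewrite gt_eqF// sqrtr_gt0 invr_gt0.
rewrite normal_pdfE// /normal_peak /normal_fun sqr_sqrtr ?invr_ge0 ?(ltW a0)//.
congr (_ * expR _); last by rewrite subr0 -mulr_natr; field; rewrite gt_eqF.
by rewrite /gauss_mass; congr (Num.sqrt _)^-1; rewrite -mulr_natr; ring.
Qed.

Lemma integral_gauss a : 0 < a ->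
  (\int[lebesgue_measure]_x (gauss a x)%:E = (gauss_mass a)%:E)%E.
Proof.
move=> a0; have m0 := gauss_mass_gt0 a a0.
have := @integral_normal_pdf R 0 (Num.sqrt a^-1).
under eq_integral do rewrite normal_pdf_gauss// EFinM.
rewrite ge0_integralZl//=; last 3 first.
- by apply/measurable_EFinP; exact: measurable_gauss.
- by move=> x _; rewrite lee_fin expR_ge0.
- by rewrite lee_fin invr_ge0 ltW.
move=> /(congr1 (fun z => (gauss_mass a)%:E * z)%E).
by rewrite muleA -EFinM divff ?gt_eqF// mul1e mule1.
Qed.

Lemma integrable_gauss a : 0 < a ->
  lebesgue_measure.-integrable setT (fun x => (gauss a x)%:E).
Proof.
move=> a0; apply/integrableP; split.
  by apply/measurable_EFinP; exact: measurable_gauss.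
under eq_integral do rewrite gee0_abs ?lee_fin ?expR_ge0//.
by rewrite integral_gauss// ltry.
Qed.

(** Half of the exponent is given up to absorb the square, by [y <= exp y] at [y = a x^2 / 4]. *)
Lemma sqr_gauss_le a x : 0 < a -> x ^+ 2 * gauss a x <= 4 / a * gauss (a / 2) x.
Proof.
move=> a0; have E : gauss a x = gauss (a / 2) x * expR (- (a / 4 * x ^+ 2)).
  by rewrite /gauss -expRD; congr expR; field.
rewrite E mulrCA mulrC ler_wpM2r ?expR_ge0//.
rewrite expRN -/(_ / _) ler_pdivrMr ?expR_gt0//.
have := expR_ge1Dx (a / 4 * x ^+ 2) => h.
apply: (@le_trans _ _ (4 / a * (a / 4 * x ^+ 2))).
  by rewrite le_eqVlt; apply/orP; left; apply/eqP; field; rewrite gt_eqF.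
by rewrite ler_wpM2l ?divr_ge0 ?(ltW a0)//; move: h; lra.
Qed.

Lemma integrable_gauss_sqr a : 0 < a ->
  lebesgue_measure.-integrable setT (fun x => ((1 + x ^+ 2) * gauss a x)%:E).
Proof.
move=> a0; have a20 : 0 < a / 2 by rewrite divr_gt0.
have i1 := integrable_gauss a a0.
have i2 : lebesgue_measure.-integrable setT
    (fun x => (4 / a)%:E * (gauss (a / 2) x)%:E)%E.
  by apply: integrableZl => //; exact: integrable_gauss.
have := @integrableD _ _ _ lebesgue_measure setT measurableT _ _ i1 i2.
apply: le_integrable => //.
  by apply/measurable_EFinP; apply: continuous_measurable_fun; rewrite /gauss; continuity.
move=> x _; rewrite -EFinM -EFinD/= lee_fin ger0_norm; last first.
  by rewrite mulr_ge0 ?expR_ge0// addr_ge0// sqr_ge0.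
apply: le_trans (ler_norm _); rewrite mulrDl mul1r lerD2l.
exact: sqr_gauss_le.
Qed.

Lemma integrable_gauss_bounded a (g : R -> R) : 0 < a -> continuous g ->
  (forall x, `|g x| <= 1 + x ^+ 2) ->
  lebesgue_measure.-integrable setT (fun x => (g x * gauss a x)%:E).
Proof.
move=> a0 cg g1; apply: le_integrable (integrable_gauss_sqr a a0) => //.
  by apply/measurable_EFinP; apply: continuous_measurable_fun; rewrite /gauss; continuity.
move=> x _; rewrite /= lee_fin !normrM ler_wpM2r// (le_trans (g1 x))//.
exact: ler_norm.
Qed.

Lemma normr_cos_le t x : `|cos (t * x)| <= 1 + x ^+ 2.
Proof.
apply: (@le_trans _ _ 1); last by rewrite lerDl sqr_ge0.
by rewrite ler_norml cos_geN1 cos_le1.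
Qed.

(** After a translation, averaging over [x] and [- x] removes the odd part pointwise, so that no
    sine integral appears for cosines. *)
Lemma integral_gauss_shift (g : R -> R) a s : continuous g ->
  (forall x, 0 <= g x) ->
  (\int[lebesgue_measure]_x (g x * gauss a (x - s))%:E =
   \int[lebesgue_measure]_x ((g (s + x) + g (s - x)) / 2 * gauss a x)%:E)%E.
Proof.
move=> cg g0.
have cp : continuous (fun x => g (s + x)).
  by apply: (continuous_compE (fun x => s + x)) => //; continuity.
have cm : continuous (fun x => g (s - x)).
  by apply: (continuous_compE (fun x => s - x)) => //; continuity.
pose f x := g (s + x) * gauss a x.
have f0 x : 0 <= f x by rewrite mulr_ge0// expR_ge0.
have mf : measurable_fun setT f.
  by apply: continuous_measurable_fun; rewrite /f /gauss; continuity.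
transitivity (\int[lebesgue_measure]_x (f x)%:E)%E.
  have f0E x : (0 <= (EFin \o f) x)%E by rewrite lee_fin.
  have mfE : measurable_fun setT (EFin \o f) by apply/measurable_EFinP.
  rewrite -[RHS](integral_translate (EFin \o f) (- s) mfE f0E).
  by apply: eq_integral => x _; rewrite /= /f [s + _]addrC subrK.
rewrite (integral_symmetrize f mf f0).
by apply: eq_integral => x _; congr EFin; rewrite /f /gauss sqrrN; ring.
Qed.

Definition gauss_cos a t :=
  Rintegral lebesgue_measure setT (fun x => cos (t * x) * gauss a x).

Lemma integral_gauss_centered a s : 0 < a ->
  (\int[lebesgue_measure]_x (gauss a (x - s))%:E = (gauss_mass a)%:E)%E.
Proof.
move=> a0; rewrite -(integral_gauss a a0).
rewrite -(@integral_translate R (fun x => (gauss a x)%:E) (- s))//.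
- by apply/measurable_EFinP; exact: measurable_gauss.
- by move=> x; rewrite lee_fin expR_ge0.
Qed.

(** Adding 1 provides the nonnegativity that the shift lemma demands. The even part in [x] of
    [cos (t s + c + t x)] is [cos (t s + c) cos (t x)], which separates [s] from the Gaussian. *)
Lemma integral_cos_gauss a s t c : 0 < a ->
  (\int[lebesgue_measure]_x ((1 + cos (t * x + c)) * gauss a (x - s))%:E =
   (gauss_mass a + cos (t * s + c) * gauss_cos a t)%:E)%E.
Proof.
move=> a0; rewrite (integral_gauss_shift (fun x => 1 + cos (t * x + c))); first last.
- by move=> x; rewrite -lerBlDl sub0r cos_geN1.
- by continuity.
have ic : lebesgue_measure.-integrable setT (fun x => (cos (t * x) * gauss a x)%:E).
  by apply: integrable_gauss_bounded => //; [continuity|exact: normr_cos_le].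
transitivity (\int[lebesgue_measure]_x ((gauss a x)%:E +
    (cos (t * s + c))%:E * (cos (t * x) * gauss a x)%:E))%E.
  apply: eq_integral => x _; rewrite -EFinM -EFinD; congr EFin.
  rewrite (_ : t * (s + x) + c = (t * s + c) + t * x); last by ring.
  rewrite (_ : t * (s - x) + c = (t * s + c) - t * x); last by ring.
  by rewrite cosD cosB; field.
rewrite integralD//; first last.
- by apply: integrableZl.
- exact: integrable_gauss.
rewrite integral_gauss// integralZl// EFinD EFinM; congr (_ + _ * _)%E.
by rewrite /gauss_cos /Rintegral fineK//; exact: integrable_fin_num.
Qed.

Definition gauss_sqr a :=
  Rintegral lebesgue_measure setT (fun x => x ^+ 2 * gauss a x).

Lemma gauss_sqr_ge0 a : 0 <= gauss_sqr a.
Proof. by apply: Rintegral_ge0 => x _; rewrite mulr_ge0 ?sqr_ge0 ?expR_ge0. Qed.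

Lemma integral_sqr_gauss a s : 0 < a ->
  (\int[lebesgue_measure]_x (x ^+ 2 * gauss a (x - s))%:E =
   (s ^+ 2 * gauss_mass a + gauss_sqr a)%:E)%E.
Proof.
move=> a0; rewrite (integral_gauss_shift (fun x => x ^+ 2)); first last.
- by move=> x; exact: sqr_ge0.
- by continuity.
have i2 : lebesgue_measure.-integrable setT (fun x => (x ^+ 2 * gauss a x)%:E).
  apply: (integrable_gauss_bounded a (fun x => x ^+ 2)) => //; first by continuity.
  by move=> x; rewrite ger0_norm ?sqr_ge0// lerDr.
transitivity (\int[lebesgue_measure]_x (s ^+ 2 * gauss a x + x ^+ 2 * gauss a x)%:E)%E.
  by apply: eq_integral => x _; congr EFin; rewrite -mulrDl; congr (_ * _); field.
rewrite ge0_integralDE; first last.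
- by move=> x; rewrite mulr_ge0 ?sqr_ge0 ?expR_ge0.
- by apply: continuous_measurable_fun; rewrite /gauss; continuity.
- by move=> x; rewrite mulr_ge0 ?sqr_ge0 ?expR_ge0.
- by apply: continuous_measurable_fun; rewrite /gauss; continuity.
rewrite ge0_integralZE.
- rewrite integral_gauss// EFinD EFinM; congr (_ + _)%E.
  by rewrite /gauss_sqr /Rintegral fineK//; exact: integrable_fin_num.
- exact: measurable_gauss.
- by move=> x; exact: expR_ge0.
- exact: sqr_ge0.
Qed.

(* Both sides compute the same integral of two convolved centered Gaussians against
   [1 + cos (t x)]; [a * b / (a + b)] is the precision of the convolution. *)
Lemma gauss_cos_conv a b t : 0 < a -> 0 < b ->
  gauss_mass a * gauss_mass b + gauss_cos a t * gauss_cos b t =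
  gauss_mass (a + b) *
    (gauss_mass (a * b / (a + b)) + gauss_cos (a * b / (a + b)) t).
Proof.
move=> a0 b0; set r := a * b / (a + b).
have ab0 : 0 < a + b by rewrite addr_gt0.
have r0 : 0 < r by rewrite divr_gt0// mulr_gt0.
pose f (z : R * R) := ((1 + cos (t * z.1 + 0)) * gauss a (z.1 - z.2) * gauss b z.2)%:E.
have c1 x : 0 <= 1 + cos (t * x + 0) by rewrite -lerBlDl sub0r cos_geN1.
have f0 z : (0 <= f z)%E by rewrite lee_fin !mulr_ge0 ?expR_ge0.
have mf : measurable_fun setT f.
  by apply/measurable_EFinP; rewrite /f /gauss /comp; measurability.
have := @fubini_tonelli _ _ _ _ R lebesgue_measure lebesgue_measure f mf f0.
rewrite /f/=.
have -> : (\int[lebesgue_measure]_y \int[lebesgue_measure]_x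
   ((1 + cos (t * x + 0)) * gauss a (x - y) * gauss b y)%:E =
   (gauss_mass a * gauss_mass b + gauss_cos a t * gauss_cos b t)%:E)%E.
  have ic : lebesgue_measure.-integrable setT (fun x => (cos (t * x) * gauss b x)%:E).
    by apply: integrable_gauss_bounded => //; [continuity|exact: normr_cos_le].
  transitivity (\int[lebesgue_measure]_y ((gauss_mass a)%:E * (gauss b y)%:E +
      (gauss_cos a t)%:E * (cos (t * y) * gauss b y)%:E))%E.
    apply: eq_integral => y _.
    under eq_integral do rewrite EFinM.
    rewrite ge0_integralZr//; first last.
    - by rewrite lee_fin expR_ge0.
    - by move=> x _; rewrite lee_fin mulr_ge0// expR_ge0.
    - by apply/measurable_EFinP; apply: continuous_measurable_fun; rewrite /gauss; continuity.
    rewrite integral_cos_gauss// -!EFinM -EFinD; congr EFin.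
    by rewrite addr0; ring.
  rewrite integralD//; first last.
  - by apply: integrableZl.
  - by apply: integrableZl => //; exact: integrable_gauss.
  rewrite !integralZl//; last exact: integrable_gauss.
  rewrite integral_gauss// EFinD !EFinM; congr (_ + _ * _)%E.
  by rewrite /gauss_cos /Rintegral fineK//; exact: integrable_fin_num.
have -> : (\int[lebesgue_measure]_x \int[lebesgue_measure]_y
   ((1 + cos (t * x + 0)) * gauss a (x - y) * gauss b y)%:E =
   (gauss_mass (a + b) * (gauss_mass r + gauss_cos r t))%:E)%E.
  transitivity (\int[lebesgue_measure]_x ((gauss_mass (a + b))%:E *
      ((1 + cos (t * x + 0)) * gauss r (x - 0))%:E))%E.
    apply: eq_integral => x _.
    (* Completing the square in [y]: [a (x - y)^2 + b y^2 = (a + b) (y - a x / (a + b))^2 + r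
       x^2]. *)
    rewrite -(integral_gauss_centered (a + b) (a * x / (a + b)))// muleC.
    rewrite -ge0_integralZl//; first last.
    - by rewrite lee_fin mulr_ge0// expR_ge0.
    - by move=> y _; rewrite lee_fin expR_ge0.
    - by apply/measurable_EFinP; apply: continuous_measurable_fun; rewrite /gauss; continuity.
    apply: eq_integral => y _; rewrite -EFinM; congr EFin.
    rewrite -!mulrA; congr (_ * _); rewrite /gauss -!expRD; congr expR.
    by rewrite /r; field; rewrite gt_eqF.
  rewrite ge0_integralZl//; first last.
  - by rewrite lee_fin ltW// gauss_mass_gt0.
  - by move=> y _; rewrite lee_fin mulr_ge0// expR_ge0.
  - by apply/measurable_EFinP; apply: continuous_measurable_fun; rewrite /gauss; continuity.
  by rewrite integral_cos_gauss// mulr0 addr0 cos0 mul1r -EFinM.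
by move=> [] ->.
Qed.

(** Characteristic function of the centered Gaussian of variance [1 / a], real by symmetry. *)
Definition gauss_chf a t := gauss_cos a t / gauss_mass a.

(** Variances add: [1/a + 1/b = (a + b) / (a b)]. The masses obey the matching product relation, so
    the constant terms of [gauss_cos_conv] cancel. *)
Lemma gauss_chf_conv a b t : 0 < a -> 0 < b ->
  gauss_chf a t * gauss_chf b t = gauss_chf (a * b / (a + b)) t.
Proof.
move=> a0 b0; have := gauss_cos_conv a b t a0 b0.
have ab0 : 0 < a + b by rewrite addr_gt0.
set r := a * b / (a + b); have r0 : 0 < r by rewrite divr_gt0// mulr_gt0.
have ma := gauss_mass_gt0 a a0; have mb := gauss_mass_gt0 b b0.
have mab := gauss_mass_gt0 _ ab0; have mr := gauss_mass_gt0 _ r0.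
have E : gauss_mass a * gauss_mass b = gauss_mass (a + b) * gauss_mass r.
  rewrite /gauss_mass -!sqrtrM ?divr_ge0 ?mulr_ge0 ?pi_ge0 ?(ltW a0) ?(ltW ab0)//.
  by congr Num.sqrt; rewrite /r; field; rewrite !gt_eqF.
rewrite mulrDr -E => /addrI H.
rewrite /gauss_chf mulrACA -invfM H E; field.
by rewrite !gt_eqF.
Qed.

Lemma cos_ge_sqr x : 1 - x ^+ 2 <= cos x.
Proof.
wlog x0 : x / 0 <= x.
  move=> H; have [/H//|/ltW x0] := leP 0 x.
  by have := H (- x); rewrite oppr_ge0 sqrrN cosN; apply.
have sin_le y : 0 <= y -> sin y <= y.
  rewrite le_eqVlt => /predU1P[<-|y0]; first by rewrite sin0.
  have [c _] := MVT_is_derive _ _ _ _ y0 (fun z => is_derive_sin z).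
  rewrite sin0 !subr0 => ->.
  by rewrite -[leRHS]mul1r ler_wpM2r ?cos_le1// ltW.
move: x0; rewrite le_eqVlt => /predU1P[<-|x0]; first by rewrite cos0; lra.
have [c /andP[c0 cx]] := MVT_is_derive _ _ _ _ x0 (fun z => is_derive_cos z).
rewrite cos0 subr0 => E; rewrite -[cos x](subrK 1) E.
by have := sin_le c (ltW c0); nra.
Qed.

(** Integrates [cos (t x) >= 1 - t^2 x^2]. The 8 is the 4 of [sqr_gauss_le] times 2, from bounding
    the mass at precision [a / 2], which is [sqrt 2] times that at [a]. *)
Lemma gauss_chf_ge a t : 0 < a -> 1 - 8 * t ^+ 2 / a <= gauss_chf a t.
Proof.
move=> a0; have m0 := gauss_mass_gt0 a a0.
have a20 : 0 < a / 2 by rewrite divr_gt0.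
rewrite /gauss_chf ler_pdivlMr//.
have RE b : 0 < b -> Rintegral lebesgue_measure setT (gauss b) = gauss_mass b.
  by move=> b0; rewrite /Rintegral integral_gauss.
have i1 := integrable_gauss a a0.
have i2 : lebesgue_measure.-integrable setT
    (fun x => (4 * t ^+ 2 / a * gauss (a / 2) x)%:E).
  rewrite (_ : (fun x => _) = (fun x => (4 * t ^+ 2 / a)%:E * (gauss (a / 2) x)%:E)%E)//.
  by apply: integrableZl => //; exact: integrable_gauss.
have m2 : gauss_mass (a / 2) <= 2 * gauss_mass a.
  rewrite /gauss_mass -[X in X * Num.sqrt _](@ger0_norm R 2)// -sqrtr_sqr -sqrtrM ?sqr_ge0//.
  rewrite ler_wsqrtr// (_ : 2 * pi / (a / 2) = 2 * (2 * pi / a)); last by field; rewrite gt_eqF.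
  by rewrite ler_wpM2r ?divr_ge0 ?mulr_ge0 ?pi_ge0 ?(ltW a0)//; lra.
apply: (@le_trans _ _ (Rintegral lebesgue_measure setT
    (fun x => gauss a x - 4 * t ^+ 2 / a * gauss (a / 2) x))).
  rewrite RintegralB// RintegralZl//; last exact: integrable_gauss.
  rewrite !RE// (_ : (1 - _) * _ = gauss_mass a - 4 * t ^+ 2 / a * (2 * gauss_mass a)); last by field; rewrite gt_eqF.
  rewrite lerD2l lerN2 ler_wpM2l//; apply: divr_ge0; last exact: ltW.
  by apply: mulr_ge0 => //; exact: sqr_ge0.
apply: le_Rintegral => //.
- exact: (integrableB measurableT i1 i2).
- by apply: integrable_gauss_bounded => //; [continuity|exact: normr_cos_le].
move=> x _; have := sqr_gauss_le a x a0; have := cos_ge_sqr (t * x).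
have := expR_gt0 (- (a * x ^+ 2 / 2)); rewrite -/(gauss a x) => g0 c0 s0.
apply: (@le_trans _ _ ((1 - (t * x) ^+ 2) * gauss a x)); last by rewrite ler_wpM2r// ltW.
rewrite mulrBl mul1r lerD2l lerN2 exprMn.
rewrite (_ : 4 * t ^+ 2 / a * _ = t ^+ 2 * (4 / a * gauss (a / 2) x)); last by ring.
by rewrite -[leLHS]mulrA ler_wpM2l ?sqr_ge0.
Qed.

(** The value at [b] is the square of the value at [2 b], so non-vanishing passes down from [2^n a];
    for large [n] it holds there by [gauss_chf_ge]. *)
Lemma gauss_chf_neq0 a t : 0 < a -> gauss_chf a t != 0.
Proof.
move=> a0.
have D n b : 0 < b -> gauss_chf (2 ^+ n * b) t != 0 -> gauss_chf b t != 0.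
  elim: n b => [|n IH] b b0; first by rewrite expr0 mul1r.
  rewrite exprSr -mulrA => /(IH (2 * b)) H.
  have := gauss_chf_conv (2 * b) (2 * b) t; rewrite !mulr_gt0// => /(_ erefl erefl).
  rewrite (_ : _ / _ = b); last by field; apply/eqP; lra.
  by move=> <-; rewrite mulf_neq0// H// mulr_gt0.
pose n := (Num.truncn (8 * t ^+ 2 / a)).+1.
apply: (D n) => //; rewrite gt_eqF//.
apply: lt_le_trans (gauss_chf_ge _ t _); last by rewrite mulr_gt0// exprn_gt0.
have n0 : n%:R < 2 ^+ n :> R by rewrite -natrX ltr_nat ltn_expl.
have : 8 * t ^+ 2 / a < 2 ^+ n by apply: lt_trans n0; exact: truncnS_gt.
rewrite subr_gt0 ltr_pdivrMr// ltr_pdivrMr ?mul1r//.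
by rewrite mulr_gt0// exprn_gt0.
Qed.

End gaussian_kernel.

(** * The law of the sum of the spins *)

Section convolution.
Context {R : realType} (P Q : probability R R).

Lemma measurable_sum2 : measurable_fun setT (fun z : R * R => z.1 + z.2).
Proof. by apply: measurable_addE; [exact: measurable_fst|exact: measurable_snd]. Qed.

Let sum2 : {mfun (R * R)%type >-> R} :=
  HB.pack (fun z : R * R => z.1 + z.2)
    (isMeasurableFun.Build _ _ _ _ _ measurable_sum2).

Definition convolution : probability R R := distribution (P \x Q)%E sum2.

Lemma ge0_integral_convolution (f : R -> R) :
  measurable_fun setT f -> (forall x, 0 <= f x) ->
  (\int[convolution]_x (f x)%:E = \int[P]_x \int[Q]_y (f (x + y)%R)%:E)%E.
Proof.
move=> mf f0; have mfE : measurable_fun setT (EFin \o f) by apply/measurable_EFinP.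
rewrite (ge0_integral_distribution _ mfE); last by move=> x; rewrite lee_fin.
rewrite fubini_tonelli1//; last by move=> x; rewrite lee_fin.
by apply: measurableT_comp mfE _; exact: measurable_sum2.
Qed.

Lemma integrable_convolution (f : R -> R) : measurable_fun setT f ->
  convolution.-integrable setT (EFin \o f) ->
  (P \x Q)%E.-integrable setT (fun z => (f (z.1 + z.2))%:E).
Proof.
move=> mf fi; have mn : measurable_fun setT (fun x => `|f x|).
  by apply: measurableT_comp.
apply/integrableP; split.
  by apply/measurable_EFinP; apply: measurableT_comp => //; exact: measurable_sum2.
have /integrableP[_] := fi.
rewrite (ge0_integral_distribution _ (f := fun x => `|(EFin \o f) x|%E))//.
by apply/measurable_EFinP.
Qed.

Lemma integral_convolution (f : R -> R) : measurable_fun setT f ->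
  convolution.-integrable setT (EFin \o f) ->
  (\int[convolution]_x (f x)%:E = \int[P]_x \int[Q]_y (f (x + y)%R)%:E)%E.
Proof.
move=> mf fi; have fi2 := integrable_convolution f mf fi.
rewrite integral_distribution//; last exact/measurable_EFinP.
by rewrite -(integral12_prod_meas1 fi2).
Qed.

End convolution.

Lemma S_N_scons {R : realType} (n : nat) (x : R) (s : nat -> R) :
  S_N n.+1 (scons x s) = x + S_N n s.
Proof. by rewrite /S_N big_ord_recl. Qed.

Section law_of_sum.
Context {R : realType} (rho : probability R R).
Hypothesis Hint : forall a b : R, 0 < a ->
  rho.-integrable setT (fun x => (expR (a * x ^+ 2 / 2 + b * x))%:E).

Definition mgf (y : R) : R := Rintegral rho setT (fun s => expR (s * y)).

Lemma integrable_expR (y : R) :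
  rho.-integrable setT (fun s => (expR (s * y))%:E).
Proof.
have := Hint 1 y ltr01; apply: le_integrable => //.
  by apply/measurable_EFinP; apply: continuous_measurable_fun; continuity.
move=> x _ /=; rewrite lee_fin !ger0_norm ?expR_ge0// ler_expR.
by have := sqr_ge0 x; lra.
Qed.

Lemma integral_mgf (y : R) :
  (\int[rho]_s (expR (s * y))%:E = (mgf y)%:E)%E.
Proof.
by rewrite /mgf /Rintegral fineK//; exact: integrable_fin_num (integrable_expR y).
Qed.

Lemma expR_sqrD (A x s : R) : 0 <= A ->
  expR (A * (x + s) ^+ 2) <= expR (2 * A * x ^+ 2) * expR (2 * A * s ^+ 2).
Proof.
move=> A0; rewrite -expRD ler_expR -mulrDr [2 * A]mulrC -mulrA ler_wpM2l//.
by have := sqr_ge0 (x - s); rewrite sqrrB sqrrD; lra.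
Qed.

(** Replaces the iterated integral [prod_int], for functions of the sum, by one integral on the
    line. The clauses are proved together: Gaussian integrability under [P], at every rate,
    justifies the Fubini step of the third one. *)
Lemma law_of_sum (n : nat) : exists P : probability R R,
  [/\ forall A : R, 0 < A -> P.-integrable setT (fun s => (expR (A * s ^+ 2))%:E),
      forall y, (\int[P]_s (expR (s * y))%:E = (mgf y ^+ n)%:E)%E &
      forall (G : R -> R) (C A : R), measurable_fun setT G -> 0 < A ->
        (forall s, `|G s| <= C * expR (A * s ^+ 2)) ->
        prod_int rho n (fun s => G (S_N n s)) = Rintegral P setT G].
Proof.
elim: n => [|n [P [iP mP eP]]].
  exists (dirac (0 : R) : probability R R); split.
  - move=> A A0; apply/integrableP; split.
      by apply/measurable_EFinP; apply: continuous_measurable_fun; continuity.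
    rewrite integral_dirac//; last first.
      by apply: measurableT_comp => //; apply/measurable_EFinP; apply: continuous_measurable_fun; continuity.
    by rewrite diracT mul1e ltry.
  - move=> y; rewrite integral_dirac//; last first.
      by apply/measurable_EFinP; apply: continuous_measurable_fun; continuity.
    by rewrite diracT mul1e mul0r expR0 expr0.
  - move=> G C A mG A0 GC; rewrite /= /Rintegral integral_dirac//; last exact/measurable_EFinP.
    by rewrite diracT mul1e /S_N big_ord0.
pose Q := convolution rho P.
have iQ A : 0 < A -> Q.-integrable setT (fun s => (expR (A * s ^+ 2))%:E).
  move=> A0; have mA : measurable_fun setT (fun s : R => expR (A * s ^+ 2)).
    by apply: continuous_measurable_fun; continuity.
  have A20 : 0 < 2 * A by rewrite mulr_gt0.
  apply/integrableP; split; first exact/measurable_EFinP.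
  under eq_integral do rewrite gee0_abs ?lee_fin ?expR_ge0//.
  rewrite ge0_integral_convolution; [|exact: mA|by move=> x; exact: expR_ge0].
  have := integrable_fin_num measurableT (iP _ A20).
  set K := (\int[P]_x _)%E => Kfin.
  apply: (@le_lt_trans _ _ (\int[rho]_x ((fine K * expR (2 * A * x ^+ 2))%:E))%E).
    apply: ge0_le_integral => //.
    - by move=> x _; apply: integral_ge0 => s _; rewrite lee_fin expR_ge0.
    - apply: (@measurable_fun_fubini_tonelli_F _ _ _ _ R P (fun z : R * R => (expR (A * (z.1 + z.2) ^+ 2))%:E)).
        by apply/measurable_EFinP; rewrite /comp; measurability.
      by move=> z; rewrite lee_fin expR_ge0.
    - by apply/measurable_EFinP; apply: continuous_measurable_fun; continuity.
    move=> x _; rewrite mulrC EFinM fineK// /K -ge0_integralZE; last 3 first.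
    - by apply: continuous_measurable_fun; continuity.
    - by move=> y; exact: expR_ge0.
    - exact: expR_ge0.
    apply: ge0_le_integralE.
    - by apply: continuous_measurable_fun; continuity.
    - by move=> y; exact: expR_ge0.
    - by apply: continuous_measurable_fun; continuity.
    - by move=> s; apply: expR_sqrD; exact: ltW.
  have K0 : 0 <= fine K by apply: fine_ge0; apply: integral_ge0 => s _; rewrite lee_fin expR_ge0.
  rewrite ge0_integralZE; [|by apply: continuous_measurable_fun; continuity|by move=> y; exact: expR_ge0|exact: K0].
  have i2 : rho.-integrable setT (fun x => (expR (2 * A * x ^+ 2))%:E).
    have A40 : 0 < 4 * A by rewrite mulr_gt0.
    rewrite (_ : (fun x => _) = (fun x => (expR (4 * A * x ^+ 2 / 2 + 0 * x))%:E)).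
      exact: Hint.
    by apply/funext => x; congr (expR _)%:E; field.
  by rewrite -(fineK (integrable_fin_num measurableT i2)) -EFinM ltry.
exists Q; split => //.
- move=> y; rewrite ge0_integral_convolution; last 2 first.
  + by apply: continuous_measurable_fun; continuity.
  + by move=> x; exact: expR_ge0.
  transitivity (\int[rho]_x ((mgf y ^+ n) * expR (x * y))%:E)%E.
    apply: eq_integral => x _; rewrite mulrC EFinM -mP -ge0_integralZE.
    + by apply: eq_integral => s _; rewrite -expRD -mulrDl.
    + by apply: continuous_measurable_fun; continuity.
    + by move=> s; exact: expR_ge0.
    + exact: expR_ge0.
  rewrite ge0_integralZE.
  + by rewrite integral_mgf -EFinM exprSr.
  + by apply: continuous_measurable_fun; continuity.
  + by move=> s; exact: expR_ge0.
  + by apply: exprn_ge0; apply: Rintegral_ge0 => s _; exact: expR_ge0.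
move=> G C A mG A0 GC.
have domi (m : probability R R) (F : R -> R) D B : measurable_fun setT F ->
    (forall s, `|F s| <= D * expR (B * s ^+ 2)) ->
    m.-integrable setT (fun s => (expR (B * s ^+ 2))%:E) ->
    m.-integrable setT (EFin \o F).
  move=> mF FD im.
  have : m.-integrable setT (fun s => D%:E * (expR (B * s ^+ 2))%:E)%E.
    exact: integrableZl.
  apply: le_integrable => //; first exact/measurable_EFinP.
  by move=> s _; rewrite -EFinM/= lee_fin; apply: le_trans (ler_norm _).
have C0 : 0 <= C.
  by have := le_trans (normr_ge0 _) (GC 0); rewrite pmulr_lge0// expR_gt0.
have A20 : 0 < 2 * A by rewrite mulr_gt0.
have GQ : Q.-integrable setT (EFin \o G) by exact: domi mG GC (iQ A A0).
have mGx (x : R) : measurable_fun setT (fun s : R => G (x + s)).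
  by apply: measurableT_comp mG _; apply: measurable_addE; [exact: measurable_cst|exact: measurable_id].
have GxC x s : `|G (x + s)| <= C * expR (2 * A * x ^+ 2) * expR (2 * A * s ^+ 2).
  by apply: le_trans (GC _) _; rewrite -mulrA ler_wpM2l// expR_sqrD// ltW.
rewrite /Rintegral integral_convolution//=.
congr fine; apply: eq_integral => x _.
rewrite (_ : (fun s => _) = (fun s => G (x + S_N n s))); last first.
  by apply/funext => s; rewrite S_N_scons.
(* The translate of [G] by [x] is dominated with rate [2 A] and an [x]-dependent constant, which is
   why the third clause quantifies over [C] and [A]. *)
rewrite (eP _ _ _ (mGx x) A20 (GxC x)) /Rintegral fineK//.
exact: (integrable_fin_num measurableT (domi _ _ _ _ (mGx x) (GxC x) (iP _ A20))).
Qed.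
End law_of_sum.

(** * The Hubbard-Stratonovich identity *)

Lemma integral_gt0 {R : realType} {d : measure_display} {T : measurableType d}
    (m : {measure set T -> \bar R}) (f : T -> R) :
  m setT != 0%E -> measurable_fun setT f -> (forall x, 0 < f x) ->
  (0 < \int[m]_x (f x)%:E)%E.
Proof.
move=> mT mf f0; rewrite lt_neqAle integral_ge0 ?andbT; last first.
  by move=> x _; rewrite lee_fin ltW.
apply/negP => /eqP/esym E.
have : (\int[m]_x `|(f x)%:E| = 0)%E.
  by under eq_integral do rewrite gee0_abs ?lee_fin ?(ltW (f0 _))//.
have mfE : measurable_fun setT (EFin \o f) by exact/measurable_EFinP.
move=> /(ae_eq_integral_abs m measurableT mfE)[A [mA A0 TA]].
case/eqP: mT; have -> : [set: T] = A; last exact: A0.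
apply/seteqP; split=> // x _; apply: TA => /= /(_ Logic.I) [] fx0.
by have := f0 x; rewrite fx0 ltxx.
Qed.

Section hubbard_stratonovich.
Context {R : realType} (rho : probability R R) (J h : R).
Hypothesis Hint : forall a b : R, 0 < a ->
  rho.-integrable setT (fun x => (expR (a * x ^+ 2 / 2 + b * x))%:E).

Lemma mgf_gt0 (y : R) : 0 < mgf rho y.
Proof.
rewrite -lte_fin -integral_mgf//; apply: integral_gt0.
- by rewrite [X in X != _]probability_setT.
- by apply: continuous_measurable_fun; continuity.
- by move=> x; exact: expR_gt0.
Qed.

Lemma expR_mul_f_CW (N : nat) (y : R) :
  expR (N%:R * f_CW rho J h y) =
  expR (- (J * N%:R * y ^+ 2 / 2)) * mgf rho (J * y + h) ^+ N.
Proof.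
rewrite /f_CW -/(mgf rho (J * y + h)) mulrDr expRD; congr (expR _ * _); first by field.
by rewrite expRM_natl lnK// posrE mgf_gt0.
Qed.

(* Completing the square: [s] enters linearly once the Gaussian variable [x] is introduced. *)
Lemma gauss_mul_weight (N : nat) (mu r x s : R) : (0 < N)%N -> 0 < r ->
  gauss (J * N%:R / r ^+ 2) (x - r * (s / N%:R - mu)) *
    expR (J * s ^+ 2 / (2 * N%:R) + h * s) =
  expR (- (J * N%:R * (mu + x / r) ^+ 2 / 2)) * expR (s * (J * (mu + x / r) + h)).
Proof.
move=> N0 r0; rewrite /gauss -!expRD; congr expR; field.
by rewrite pnatr_eq0 -lt0n N0 gt_eqF.
Qed.

(** Tonelli lets [s] be integrated first. Once the square is completed [s] is linear in the
    exponent, so its integral is a power of [mgf], which combines with the remaining Gaussian factor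
    into [exp (N f)]. *)
Lemma integral_gauss_weight (P : probability R R) (N : nat) (mu r : R)
    (phi : R -> R) :
  (forall y, (\int[P]_s (expR (s * y))%:E = (mgf rho y ^+ N)%:E)%E) ->
  (0 < N)%N -> 0 < r -> continuous phi -> (forall x, 0 <= phi x) ->
  (\int[P]_s ((\int[lebesgue_measure]_x
      (phi x * gauss (J * N%:R / r ^+ 2) (x - r * (s / N%:R - mu)))%:E) *
      (expR (J * s ^+ 2 / (2 * N%:R) + h * s))%:E) =
   \int[lebesgue_measure]_x (phi x * expR (N%:R * f_CW rho J h (mu + x / r)))%:E)%E.
Proof.
move=> mP N0 r0 cphi phi0; set a := J * N%:R / r ^+ 2.
have mphi : measurable_fun setT phi by exact: continuous_measurable_fun.
pose f (z : R * R) := phi z.2 * gauss a (z.2 - r * (z.1 / N%:R - mu)) *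
  expR (J * z.1 ^+ 2 / (2 * N%:R) + h * z.1).
have f0 z : 0 <= f z by rewrite !mulr_ge0 ?expR_ge0.
have mf : measurable_fun setT (EFin \o f).
  apply/measurable_EFinP; apply: measurable_mulE.
    apply: measurable_mulE.
      by apply: measurableT_comp mphi _; exact: measurable_snd.
    by rewrite /gauss; measurability.
  by measurability.
have f0E z : (0 <= (EFin \o f) z)%E by rewrite lee_fin.
have H := @fubini_tonelli _ _ _ _ R P lebesgue_measure (EFin \o f) mf f0E.
transitivity (\int[P]_s \int[lebesgue_measure]_x (f (s, x))%:E)%E.
  apply: eq_integral => s _; rewrite muleC -ge0_integralZE.
  - by apply: eq_integral => x _; rewrite /f mulrC.
  - by apply: continuous_measurable_fun; rewrite /gauss; continuity.
  - by move=> x; rewrite mulr_ge0// expR_ge0.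
  - exact: expR_ge0.
rewrite [LHS]H; apply: eq_integral => x _.
transitivity (\int[P]_s ((phi x * expR (- (J * N%:R * (mu + x / r) ^+ 2 / 2))) *
    expR (s * (J * (mu + x / r) + h)))%:E)%E.
  apply: eq_integral => s _; congr EFin.
  by rewrite /f -mulrA gauss_mul_weight// mulrA.
rewrite ge0_integralZE.
- by rewrite mP -EFinM expR_mul_f_CW mulrA.
- by apply: continuous_measurable_fun; continuity.
- by move=> s; exact: expR_ge0.
- by rewrite mulr_ge0// expR_ge0.
Qed.

End hubbard_stratonovich.

(** * Smoothness of the free energy *)

Lemma is_derive_pow {R : realType} (n : nat) (x : R) :
  is_derive x 1 (fun y : R => y ^+ n) (n%:R * x ^+ n.-1).
Proof.
have := @is_deriveX R _ id n x 1 1 (is_derive_id x 1).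
by rewrite exprfctE => /is_derive_eq; apply; rewrite /GRing.scale/= mulr1.
Qed.

Section smoothness.
Context {R : realType} (rho : probability R R).
Hypothesis Hint : forall a b : R, 0 < a ->
  rho.-integrable setT (fun x => (expR (a * x ^+ 2 / 2 + b * x))%:E).

Definition moment (j : nat) (y : R) : R :=
  Rintegral rho setT (fun s => s ^+ j * expR (s * y)).

Lemma pow_le_expR (j : nat) (s : R) : `|s| ^+ j <= j`!%:R * expR `|s|.
Proof.
case: j => [|j]; first by rewrite expr0 fact0 mul1r -expR0 ler_expR.
have := @expR_ge1Dxn R `|s| j (normr_ge0 s) => H.
rewrite mulrC -ler_pdivrMr ?ltr0n ?fact_gt0//; apply: le_trans H.
by rewrite lerDr.
Qed.

Lemma expR_norm_le (c s : R) : 0 <= c ->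
  expR (`|s| * c) <= expR (s * c) + expR (s * - c).
Proof.
move=> c0; have [s0|s0] := leP 0 s.
  by rewrite ger0_norm// lerDl expR_ge0.
by rewrite ltr0_norm// mulNr mulrN lerDr expR_ge0.
Qed.

(** The power costs one unit of rate, by [|s|^j <= j! exp |s|]. Splitting [exp (|s| (c + 1))] into
    two exponentials gives a majorant integrable under [rho] and uniform in [|y| <= c], as
    differentiation under the integral requires. *)
Lemma moment_term_le (j : nat) (c y s : R) : `|y| <= c ->
  `|s ^+ j * expR (s * y)| <=
  j`!%:R * (expR (s * (c + 1)) + expR (s * - (c + 1))).
Proof.
move=> yc; have c0 : 0 <= c by apply: le_trans yc.
rewrite normrM normrX [X in _ * X]ger0_norm ?expR_ge0//.
apply: (@le_trans _ _ (j`!%:R * expR `|s| * expR (`|s| * c))).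
  apply: ler_pM; rewrite ?exprn_ge0 ?expR_ge0 ?pow_le_expR//.
  rewrite ler_expR; apply: le_trans (ler_norm _) _.
  by rewrite normrM ler_wpM2l.
rewrite -mulrA ler_wpM2l// -expRD.
rewrite (_ : `|s| + `|s| * c = `|s| * (c + 1)); last by ring.
by apply: expR_norm_le; rewrite addr_ge0.
Qed.

Lemma integrable_moment_bound (j : nat) (c : R) :
  rho.-integrable setT
    (fun s => (j`!%:R * (expR (s * (c + 1)) + expR (s * - (c + 1))))%:E).
Proof.
have := integrableZl measurableT j`!%:R (integrableD measurableT
  (integrable_expR rho Hint (c + 1)) (integrable_expR rho Hint (- (c + 1)))).
by [].
Qed.

Lemma integrable_moment (j : nat) (y : R) :
  rho.-integrable setT (fun s => (s ^+ j * expR (s * y))%:E).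
Proof.
apply: le_integrable (integrable_moment_bound j `|y|) => //.
  by apply/measurable_EFinP; apply: continuous_measurable_fun; continuity.
move=> s _; rewrite /= lee_fin; apply: le_trans (ler_norm _).
exact: moment_term_le.
Qed.

Lemma is_derive_moment_term (j : nat) (s x : R) :
  is_derive x 1 (fun x => s ^+ j * expR (s * x)) (s ^+ j.+1 * expR (s * x)).
Proof.
have D : is_derive x 1 (fun x : R => s * x) (s *: 1).
  exact: is_deriveZ.
have D2 := @is_derive1_comp R expR (fun x : R => s * x) x _ _ (is_derive_expR _) D.
have D3 : is_derive x 1 (fun x : R => s ^+ j * expR (s * x)) (s ^+ j *: (expR (s * x) * (s *: 1))).
  exact: is_deriveZ.
by apply: is_derive_eq D3 _; rewrite /GRing.scale/= exprS; ring.
Qed.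

Lemma is_derive_moment (j : nat) (y : R) :
  is_derive y 1 (moment j) (moment j.+1 y).
Proof.
pose f (x s : R) := s ^+ j * expR (s * x).
pose c := `|y| + 1.
have Iy : `]y - 1, y + 1[%classic y by rewrite /= in_itv/=; apply/andP; split; lra.
have d1 x s : derive1 (f ^~ s) x = s ^+ j.+1 * expR (s * x).
  by rewrite derive1E; apply: (derive_val (is_derive := is_derive_moment_term j s x)).
have intf x : `]y - 1, y + 1[%classic x -> rho.-integrable setT (EFin \o f x).
  by move=> _; exact: integrable_moment.
have df x s : `]y - 1, y + 1[%classic x -> setT s -> derivable (f ^~ s) x 1.
  by move=> _ _; apply: ex_derive; exact: is_derive_moment_term.
have G0 s : 0 <= j.+1`!%:R * (expR (s * (c + 1)) + expR (s * - (c + 1))).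
  by rewrite mulr_ge0// addr_ge0// expR_ge0.
have Gub x s : `]y - 1, y + 1[%classic x -> setT s ->
    `|derive1 (f ^~ s) x| <= j.+1`!%:R * (expR (s * (c + 1)) + expR (s * - (c + 1))).
  rewrite /= in_itv/= => /andP[yx xy] _; rewrite d1; apply: moment_term_le.
  have -> : x = y + (x - y) by ring.
  apply: le_trans (ler_normD _ _) _; rewrite /c lerD2l ler_norml.
  by apply/andP; split; lra.
have iG := integrable_moment_bound j.+1 c.
have D := @derivable_under_integral R _ _ rho f setT measurableT y (y - 1) (y + 1) Iy intf df _ G0 iG Gub.
have E := @differentiation_under_integral R _ _ rho f setT measurableT y (y - 1) (y + 1) Iy intf df _ G0 iG Gub.
apply: DeriveDef => //.
rewrite -derive1E E /moment; apply: eq_Rintegral => s _.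
exact: d1.
Qed.

Lemma moment0 : moment 0 = mgf rho.
Proof.
by apply/funext => y; apply: eq_Rintegral => s _; rewrite expr0 mul1r.
Qed.

Lemma is_derive_mgf (y : R) : is_derive y 1 (mgf rho) (moment 1 y).
Proof. by rewrite -moment0; exact: is_derive_moment. Qed.

Context (J h : R).

(** A class of expressions closed under differentiation, giving derivatives of all orders without
    computing them. The logarithm is left out: the first derivative of [f_CW] already belongs to the
    class. *)
Inductive smooth_alg : (R -> R) -> Prop :=
| smooth_cst c : smooth_alg (fun=> c)
| smooth_id : smooth_alg (fun x => x)
| smooth_moment j : smooth_alg (fun x => moment j (J * x + h))
| smooth_inv : smooth_alg (fun x => (mgf rho (J * x + h))^-1)
| smooth_add F G : smooth_alg F -> smooth_alg G ->
    smooth_alg (fun x => F x + G x)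
| smooth_mul F G : smooth_alg F -> smooth_alg G ->
    smooth_alg (fun x => F x * G x).

Lemma is_derive_affine_comp (F F' : R -> R) (x : R) :
  (forall y : R, is_derive y 1 F (F' y)) ->
  is_derive x 1 (fun x => F (J * x + h)) (J * F' (J * x + h)).
Proof.
move=> FF'.
have D : is_derive x 1 (fun x : R => J * x + h) (J *: 1 + 0).
  by apply: is_deriveD; exact: is_deriveZ.
have := @is_derive1_comp R F (fun x : R => J * x + h) x _ _ (FF' _) D.
by move/is_derive_eq; apply; rewrite /GRing.scale/= mulr1 addr0 mulrC.
Qed.

Lemma smooth_alg_derive (F : R -> R) : smooth_alg F ->
  exists2 F', smooth_alg F' & forall x : R, is_derive x 1 F (F' x).
Proof.
elim=> {F} [c||j||F G _ [F' sF' dF] _ [G' sG' dG]|F G sF [F' sF' dF] sG [G' sG' dG]].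
- by exists (fun=> 0) => [|x]; [exact: smooth_cst|exact: is_derive_cst].
- by exists (fun=> 1) => [|x]; [exact: smooth_cst|exact: is_derive_id].
- exists (fun x => J * moment j.+1 (J * x + h)).
    by apply: smooth_mul; [exact: smooth_cst|exact: smooth_moment].
  by move=> x; apply: is_derive_affine_comp => y; exact: is_derive_moment.
- pose iM x := (mgf rho (J * x + h))^-1.
  exists (fun x => - J * (moment 1 (J * x + h) * (iM x * iM x))).
    apply: smooth_mul; first exact: smooth_cst.
    apply: smooth_mul; first exact: smooth_moment.
    by apply: smooth_mul; exact: smooth_inv.
  move=> x; have D := is_derive_affine_comp _ _ x is_derive_mgf.
  have M0 : mgf rho (J * x + h) != 0 by rewrite gt_eqF// mgf_gt0.
  have := @is_deriveV R (fun x => mgf rho (J * x + h)) x _ 1 M0 D.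
  by move/is_derive_eq; apply; rewrite /GRing.scale/= /iM; field.
- exists (fun x => F' x + G' x); first exact: smooth_add.
  by move=> x; apply: is_deriveD.
- exists (fun x => F x * G' x + G x * F' x).
    by apply: smooth_add; exact: smooth_mul.
  by move=> x; apply: is_deriveM.
Qed.

Definition f_CW_derive (x : R) : R :=
  - J * x + J * (moment 1 (J * x + h) * (mgf rho (J * x + h))^-1).

Lemma is_derive_f_CW (x : R) : is_derive x 1 (f_CW rho J h) (f_CW_derive x).
Proof.
have D := is_derive_affine_comp _ _ x is_derive_mgf.
have M0 : 0 < mgf rho (J * x + h) by exact: mgf_gt0.
have D1 := @is_derive1_comp R (@ln R) (fun x => mgf rho (J * x + h)) x _ _ (is_derive1_ln M0) D.
have D2 : is_derive x 1 (fun x : R => - (J / 2) * x ^+ 2) (- (J / 2) *: (2%:R * x ^+ 1)).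
  by apply: is_deriveZ; exact: is_derive_pow.
have D3 : is_derive x 1 (f_CW rho J h) _ := is_deriveD D2 D1.
apply: is_derive_eq D3 _; rewrite /GRing.scale/= /f_CW_derive.
by field; rewrite gt_eqF.
Qed.

End smoothness.

(** * Taylor expansion and growth of the free energy *)

Section peano_taylor.
Context {R : realType}.
Implicit Types (F : R -> R) (x u c e : R).

(** [is_derive] asserts that each derivative exists, which a value of [derive1n] alone does not. *)
Definition smooth F := forall n x, is_derive x 1 (derive1n n F) (derive1n n.+1 F x).

Lemma smooth_derive1 F : smooth F -> smooth (derive1 F).
Proof. by move=> sF n x; have := sF n.+1 x; rewrite /derive1n !iterSr. Qed.

(** Integrates a little-o estimate by the mean value theorem: the remainder at [u] is its derivative
    at some [v] with [|v| < |u|], times [u]. The same [e] and [d] serve. *)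
Lemma peano_step F (mu c : R) (m : nat) :
  (forall x, is_derive x 1 F (derive1 F x)) ->
  (forall e, 0 < e -> exists2 d, 0 < d & forall u, `|u| < d ->
    `|derive1 F (mu + u) - c * u ^+ m| <= e * `|u| ^+ m) ->
  forall e, 0 < e -> exists2 d, 0 < d & forall u, `|u| < d ->
    `|F (mu + u) - F mu - c / m.+1%:R * u ^+ m.+1| <= e * `|u| ^+ m.+1.
Proof.
move=> dF H e e0; have [d d0 Hd] := H e e0; exists d => // u ud.
pose Phi u := F (mu + u) - c / m.+1%:R * u ^+ m.+1.
pose phi u := derive1 F (mu + u) - c * u ^+ m.
have dPhi x : is_derive x 1 Phi (phi x).
  have D1 : is_derive x 1 (fun u : R => mu + u) (0 + 1) by apply: is_deriveD.
  have D2 := @is_derive1_comp R F (fun u : R => mu + u) x _ _ (dF _) D1.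
  have D3 : is_derive x 1 (fun u : R => c / m.+1%:R * u ^+ m.+1)
      ((c / m.+1%:R) *: (m.+1%:R * x ^+ m)).
    by apply: is_deriveZ; exact: is_derive_pow.
  have D4 : is_derive x 1 Phi _ := is_deriveB D2 D3.
  apply: is_derive_eq D4 _; rewrite /GRing.scale/= /phi add0r mulr1; congr (_ - _).
  by rewrite mulrA divfK ?pnatr_eq0.
have -> : F (mu + u) - F mu - c / m.+1%:R * u ^+ m.+1 = Phi u - Phi 0.
  by rewrite /Phi addr0 expr0n/=; ring.
have step v : `|v| <= `|u| -> `|phi v * u| <= e * `|u| ^+ m.+1.
  move=> vu; rewrite normrM exprSr mulrA ler_wpM2r//.
  apply: le_trans (Hd v (le_lt_trans vu ud)) _.
  by rewrite ler_wpM2l ?(ltW e0)// lerXn2r ?nnegrE.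
have [u0|u0|->] := ltgtP u 0; last first.
- by rewrite subrr normr0 mulr_ge0 ?exprn_ge0 ?(ltW e0).
- have [v /andP[v0 vu] ->] := MVT_is_derive _ _ _ _ u0 dPhi.
  by rewrite subr0; apply: step; rewrite !gtr0_norm// ltW.
- have [v /andP[uv v0]] := MVT_is_derive _ _ _ _ u0 dPhi.
  rewrite sub0r distrC mulrN -mulNr => ->; rewrite mulNr normrN.
  by apply: step; rewrite !ltr0_norm// lerN2 ltW.
Qed.

(** Induction through [derive1 F], starting from continuity of the first derivative. Each
    integration divides the leading coefficient by the new exponent, which builds the factorial. *)
Lemma peano_taylor F (mu : R) (m : nat) : smooth F ->
  (forall j, (1 <= j <= m)%N -> derive1n j F mu = 0) ->
  forall e, 0 < e -> exists2 d, 0 < d & forall u, `|u| < d ->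
    `|F (mu + u) - F mu - derive1n m.+1 F mu / m.+1`!%:R * u ^+ m.+1|
      <= e * `|u| ^+ m.+1.
Proof.
elim: m F => [|m IH] F sF F0.
  apply: (peano_step F mu (derive1n 1 F mu) 0 (sF 0%N)) => e e0.
  have := is_derive_continuous _ _ (sF 1%N) mu.
  move/cvgrPdist_lt => /(_ e e0) /nbhs_ballP[d /= d0 Hd]; exists d => // u ud.
  rewrite !expr0 !mulr1 distrC; apply/ltW/Hd => /=.
  suff : `|mu - (mu + u)| < d by [].
  by rewrite opprD addNKr normrN.
have E : derive1n m.+2 F mu / m.+2`!%:R =
    (derive1n m.+2 F mu / m.+1`!%:R) / m.+2%:R.
  by rewrite (factS m.+1) natrM invfM mulrA mulrAC.
rewrite E; apply: (peano_step F mu (derive1n m.+2 F mu / m.+1`!%:R) m.+1 (sF 0%N)) => e e0.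
have [|d d0 Hd] := IH _ (smooth_derive1 _ sF) _ e e0.
  by move=> j /andP[j1 jm]; rewrite /derive1n -iterSr; apply: (F0 j.+1); rewrite /= ltnS.
exists d => // u ud; have := Hd u ud.
have -> : derive1 F mu = 0 by have := F0 1%N; apply.
by rewrite subr0 /derive1n -iterSr.
Qed.

End peano_taylor.

Section free_energy.
Context {R : realType} (rho : probability R R) (J h : R).
Hypothesis Hint : forall a b : R, 0 < a ->
  rho.-integrable setT (fun x => (expR (a * x ^+ 2 / 2 + b * x))%:E).
Hypothesis HJ : 0 < J.
Local Notation f := (f_CW rho J h).

Lemma derive1_is_derive (F F' : R -> R) :
  (forall x : R, is_derive x 1 F (F' x)) -> derive1 F = F'.
Proof.
move=> D; apply/funext => x; rewrite derive1E.
exact: (derive_val (is_derive := D x)).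
Qed.

Lemma smooth_alg_smooth (F : R -> R) : smooth_alg rho J h F -> smooth F.
Proof.
move=> sF n; suff: smooth_alg rho J h (derive1n n F).
  move=> /(smooth_alg_derive _ Hint)[F' _ D] x.
  by rewrite /derive1n iterS (derive1_is_derive _ _ D).
elim: n => [//|n /(smooth_alg_derive _ Hint)[F' sF' D]].
by rewrite /derive1n iterS (derive1_is_derive _ _ D).
Qed.

Lemma derive1_f_CW : derive1 f = f_CW_derive rho J h.
Proof. by apply: derive1_is_derive => x; exact: is_derive_f_CW. Qed.

Lemma smooth_f_CW : smooth f.
Proof.
have s1 : smooth_alg rho J h (f_CW_derive rho J h).
  apply: smooth_add; apply: smooth_mul.
  - exact: smooth_cst.
  - exact: smooth_id.
  - exact: smooth_cst.
  - by apply: smooth_mul; [exact: smooth_moment|exact: smooth_inv].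
move=> [|n] x; first by rewrite derive1n1 derive1_f_CW; exact: is_derive_f_CW.
have E j : derive1n j.+1 f = derive1n j (f_CW_derive rho J h).
  by rewrite /derive1n iterSr derive1_f_CW.
by rewrite !E; exact: smooth_alg_smooth.
Qed.

(** The quantity is [mgf^2] times the variance of the law proportional to [exp (s y) d rho(s)]. If
    it vanished, [rho] would be concentrated at the tilted mean [m]. *)
Lemma variance_gt0 (y : R) : (forall a : R, (rho [set a] < 1)%E) ->
  0 < moment rho 2 y * mgf rho y - moment rho 1 y ^+ 2.
Proof.
move=> nd; have M0 : 0 < mgf rho y by exact: mgf_gt0.
set m := moment rho 1 y / mgf rho y.
have i j := integrable_moment rho Hint j y.
have i1 : rho.-integrable setT (fun s => (2 * m * (s ^+ 1 * expR (s * y)))%:E).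
  exact: (integrableZl measurableT (2 * m) (i 1%N)).
have i0 : rho.-integrable setT (fun s => (m ^+ 2 * (s ^+ 0 * expR (s * y)))%:E).
  exact: (integrableZl measurableT (m ^+ 2) (i 0%N)).
have i21 : rho.-integrable setT (fun s => (s ^+ 2 * expR (s * y) - 2 * m * (s ^+ 1 * expR (s * y)))%:E).
  exact: (integrableB measurableT (i 2%N) i1).
have E : Rintegral rho setT (fun s => (s - m) ^+ 2 * expR (s * y)) =
    moment rho 2 y - 2 * m * moment rho 1 y + m ^+ 2 * mgf rho y.
  rewrite -moment0 /moment.
  rewrite -RintegralZl ?i// -[X in _ + X]RintegralZl ?i//.
  rewrite -RintegralB ?i// -RintegralD//.
  by apply: eq_Rintegral => s _; rewrite expr0 expr1; ring.
have V : 0 < Rintegral rho setT (fun s => (s - m) ^+ 2 * expR (s * y)).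
  rewrite lt_neqAle Rintegral_ge0 ?andbT; last first.
    by move=> s _; rewrite mulr_ge0 ?sqr_ge0 ?expR_ge0.
  have i2 : rho.-integrable setT (fun s => ((s - m) ^+ 2 * expR (s * y))%:E).
    have := integrableD measurableT i21 i0; apply: eq_integrable => // s _.
    by rewrite /= -EFinD; congr EFin; rewrite expr0 expr1; ring.
  have mV : measurable_fun setT (fun s : R => ((s - m) ^+ 2 * expR (s * y))%:E).
    by apply/measurable_EFinP; apply: continuous_measurable_fun; continuity.
  apply/negP => /eqP/esym E0.
  have : (\int[rho]_s `|((s - m) ^+ 2 * expR (s * y))%:E| = 0)%E.
    transitivity (\int[rho]_s ((s - m)%R ^+ 2 * expR (s * y))%:E)%E.
      apply: eq_integral => s _; rewrite gee0_abs// lee_fin.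
      by rewrite mulr_ge0 ?sqr_ge0 ?expR_ge0.
    by rewrite -(fineK (integrable_fin_num measurableT i2)); congr EFin.
  move=> /(ae_eq_integral_abs rho measurableT mV)[A [mA A0 TA]].
  have mm : measurable [set m] by exact: measurable_set1.
  have : (rho (~` [set m]) = 0)%E.
    apply: (@subset_measure0 _ _ _ rho _ A) => //; first exact: measurableC.
    move=> s /= sm; apply: TA => /= /(_ Logic.I) [] /eqP.
    by rewrite mulf_eq0 sqrf_eq0 subr_eq0 (gt_eqF (expR_gt0 _)) orbF => /eqP.
  have := nd m; rewrite probability_setC// => rm /eqP.
  by rewrite sube_eq ?add0e; [|by []|by []] => /eqP r1; rewrite -r1 ltxx in rm.
have -> : moment rho 2 y * mgf rho y - moment rho 1 y ^+ 2 =
    mgf rho y * Rintegral rho setT (fun s => (s - m) ^+ 2 * expR (s * y)).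
  by rewrite E /m; field; rewrite gt_eqF.
by rewrite mulr_gt0.
Qed.

(** The second derivative is [- J + J^2] times a tilted variance. For [k = 1] this makes the
    limiting variance positive. *)
Lemma derive2_f_CW_gt (x : R) : (forall a : R, (rho [set a] < 1)%E) ->
  - J < derive1n 2 f x.
Proof.
move=> nd; rewrite /derive1n iterSr/= derive1_f_CW.
pose y := J * x + h.
have M0 : 0 < mgf rho y by exact: mgf_gt0.
have D1 := is_derive_affine_comp J h _ _ x (is_derive_moment rho Hint 1).
have D0 := is_derive_affine_comp J h _ _ x (is_derive_mgf rho Hint).
have Di := @is_deriveV R (fun x => mgf rho (J * x + h)) x _ 1 (lt0r_neq0 M0) D0.
have D : is_derive x 1 (f_CW_derive rho J h) _ :=
  is_deriveD (is_deriveZ (- J) (is_derive_id x 1)) (is_deriveZ J (is_deriveM D1 Di)).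
rewrite derive1E (derive_val (is_derive := D)) /GRing.scale/= mulr1 -/y.
have V := variance_gt0 y nd.
rewrite [ltRHS](_ : _ = - J + J ^+ 2 * ((moment rho 2 y * mgf rho y - moment rho 1 y ^+ 2) / mgf rho y ^+ 2)).
  by rewrite ltrDl mulr_gt0 ?divr_gt0 ?exprn_gt0.
by field; rewrite gt_eqF.
Qed.

Lemma f_CW_growth : exists C, forall x, f x <= C - J * x ^+ 2 / 4.
Proof.
have J4 : 0 < 4 * J by rewrite mulr_gt0.
have iK : rho.-integrable setT (fun s => (expR (2 * J * s ^+ 2))%:E).
  rewrite (_ : (fun s => _) = (fun x => (expR (4 * J * x ^+ 2 / 2 + 0 * x))%:E)).
    exact: Hint.
  by apply/funext => s; congr (expR _)%:E; field.
pose K := Rintegral rho setT (fun s => expR (2 * J * s ^+ 2)).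
have K0 : 0 < K.
  apply: fine_gt0; rewrite ltey_eq (integrable_fin_num measurableT iK) andbT.
  apply: integral_gt0; first by rewrite [X in X != _]probability_setT.
    by apply: continuous_measurable_fun; continuity.
  by move=> x; exact: expR_gt0.
exists (ln K + h ^+ 2 / (4 * J)) => x.
have M0 : 0 < mgf rho (J * x + h) by exact: mgf_gt0.
have MK : mgf rho (J * x + h) <= expR (J * x ^+ 2 / 4 + h ^+ 2 / (4 * J)) * K.
  rewrite /mgf /K -RintegralZl//; apply: le_Rintegral => //.
  - exact: integrable_expR.
  - exact: (integrableZl measurableT (expR (J * x ^+ 2 / 4 + h ^+ 2 / (4 * J))) iK).
  move=> s _; rewrite -expRD ler_expR.
  have := sqr_ge0 (4 * J * s - (J * x + h)); have := sqr_ge0 (J * x - h) => h1 h2.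
  (* Young's inequality [s (J x + h) <= 2 J s^2 + (J x + h)^2 / (8 J)], tuned so that only half of
     the quadratic term [J x^2 / 2] of [f_CW] is consumed. *)
  rewrite -subr_ge0 (_ : _ - _ = ((4 * J * s - (J * x + h)) ^+ 2 + (J * x - h) ^+ 2) / (8 * J)); last by field; rewrite gt_eqF.
  by apply: divr_ge0; [exact: addr_ge0|apply: mulr_ge0 => //; exact: ltW].
rewrite /f_CW -/(mgf rho (J * x + h)).
have : ln (mgf rho (J * x + h)) <= J * x ^+ 2 / 4 + h ^+ 2 / (4 * J) + ln K.
  rewrite -[X in _ <= X + _]expRK -lnM ?posrE ?expR_gt0//.
  by rewrite ler_ln ?posrE ?mulr_gt0 ?expR_gt0.
by move: (ln (mgf _ _)) (ln K) (h ^+ 2 / _) => *; lra.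
Qed.

End free_energy.

(** * Laplace asymptotics *)

Section laplace.
Context {R : realType}.

Lemma compact_negative_bound (g : R -> R) (a b : R) : a <= b -> continuous g ->
  (forall u, u \in `[a, b] -> g u < 0) ->
  exists2 e, 0 < e & forall u, u \in `[a, b] -> g u <= - e.
Proof.
move=> ab cg g0; have [x xab Hx] := EVT_max ab (continuous_subspaceT cg).
by exists (- g x) => [|u uab]; [rewrite oppr_gt0 g0|rewrite opprK Hx].
Qed.

Lemma pow_even_ge0 (k : nat) (x : R) : 0 <= x ^+ k.*2.
Proof. by rewrite -mul2n exprM exprn_ge0 ?sqr_ge0. Qed.

(** Three zones: the local estimate for [|u| < d], compactness for [d <= |u| <= D], the growth bound
    beyond. The conclusion is a disjunction because the local bound has order [2 k] and the other
    two are quadratic. *)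
Lemma global_decay (g : R -> R) (k : nat) (C b d eta : R) :
  continuous g -> (forall u, u != 0 -> g u < 0) ->
  0 < b -> (forall u, g u <= C - b * u ^+ 2) ->
  0 < d -> 0 < eta -> (forall u, `|u| < d -> g u <= - (eta * u ^+ k.*2)) ->
  exists2 c, 0 < c &
    forall u, g u <= - (c * u ^+ k.*2) \/ g u <= - (c * u ^+ 2).
Proof.
move=> cg g0 b0 gC d0 eta0 gd.
(* Beyond [D] the constant [C] costs at most half of the decay [b u^2]. *)
pose D := Num.sqrt (2 * `|C| / b) + d.
have D0 : 0 < D by rewrite ltr_wpDl// sqrtr_ge0.
have dD : d <= D by rewrite lerDr sqrtr_ge0.
have DC : C <= b / 2 * D ^+ 2.
  apply: le_trans (ler_norm _) _.
  have -> : `|C| = b / 2 * (2 * `|C| / b) by field; rewrite gt_eqF.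
  rewrite ler_wpM2l ?divr_ge0 ?(ltW b0)//.
  have C0 : 0 <= 2 * `|C| / b by rewrite divr_ge0 ?mulr_ge0 ?(ltW b0).
  rewrite -[leLHS]sqr_sqrtr// lerXn2r ?nnegrE ?sqrtr_ge0 ?(ltW D0)//.
  by rewrite lerDl ltW.
have [e1 e10 H1] : exists2 e, 0 < e & forall u, u \in `[d, D] -> g u <= - e.
  apply: compact_negative_bound => // u; rewrite in_itv/= => /andP[du _].
  by apply: g0; rewrite gt_eqF// (lt_le_trans d0).
have [e2 e20 H2] : exists2 e, 0 < e & forall u, u \in `[- D, - d] -> g u <= - e.
  apply: compact_negative_bound => //; first by rewrite lerN2.
  move=> u; rewrite in_itv/= => /andP[_ ud].
  by apply: g0; rewrite lt_eqF// (le_lt_trans ud)// oppr_lt0.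
pose c := Num.min eta (Num.min (b / 2) (Num.min (e1 / D ^+ 2) (e2 / D ^+ 2))).
exists c; first by rewrite !lt_min eta0 !divr_gt0// exprn_gt0.
have cle : [/\ c <= eta, c <= b / 2, c <= e1 / D ^+ 2 & c <= e2 / D ^+ 2].
  by split; rewrite /c !ge_min lexx ?orbT.
case: cle => ceta cb c1 c2 u.
have middle e : c <= e / D ^+ 2 -> 0 < e -> `|u| <= D -> g u <= - e ->
    g u <= - (c * u ^+ 2).
  move=> ce e0 uD /le_trans; apply; rewrite lerN2.
  have uD2 : u ^+ 2 <= D ^+ 2.
    by rewrite -(real_normK (num_real u)) lerXn2r ?nnegrE ?(ltW D0).
  apply: (@le_trans _ _ (e / D ^+ 2 * u ^+ 2)); first by rewrite ler_wpM2r ?sqr_ge0.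
  rewrite mulrAC ler_pdivrMr ?exprn_gt0// ler_wpM2l// ltW//.
have [ud|du] := ltP `|u| d.
  left; apply: le_trans (gd u ud) _.
  by rewrite lerN2 ler_wpM2r// pow_even_ge0.
right; have [uD|Du] := leP `|u| D; last first.
  have uD2 : D ^+ 2 <= u ^+ 2.
    by rewrite -[leRHS](real_normK (num_real u)) lerXn2r ?nnegrE ?(ltW D0)// ltW.
  apply: le_trans (gC u) _.
  have h1 : c * u ^+ 2 <= b / 2 * u ^+ 2 by rewrite ler_wpM2r ?sqr_ge0.
  have h2 : b / 2 * D ^+ 2 <= b / 2 * u ^+ 2 by rewrite ler_wpM2l ?divr_ge0 ?(ltW b0).
  by move: (c * u ^+ 2) (u ^+ 2) (D ^+ 2) h1 h2 DC => *; lra.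
have [u0|u0] := leP 0 u.
  apply: (middle e1) => //; apply: H1.
  by rewrite in_itv/=; move: du uD; rewrite !ger0_norm// => -> ->.
apply: (middle e2) => //; apply: H2; rewrite in_itv/= lerNl [_ <= - d]lerNr.
by move: du uD; rewrite !ltr0_norm// => -> ->.
Qed.

(** Order [2 k] is scale invariant and gives [- c x^(2k)]; the quadratic case gains the factor
    [M / r^2 >= 1]. The additive [c] pays for [|x| < 1], where [x^(2k)] falls below [x^2]. The bound
    is independent of [M]. *)
Lemma scaled_decay (g : R -> R) (k : nat) (c r M : R) : (0 < k)%N -> 0 < c ->
  1 <= r -> r ^+ k.*2 = M ->
  (forall u, g u <= - (c * u ^+ k.*2) \/ g u <= - (c * u ^+ 2)) ->
  forall x, M * g (x / r) <= c - c * x ^+ 2.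
Proof.
move=> k0 c0 r1 rM H x; have r0 : 0 < r by apply: lt_le_trans r1.
have M0 : 0 < M by rewrite -rM exprn_gt0.
have [h|h] := H (x / r).
  apply: (@le_trans _ _ (M * - (c * (x / r) ^+ k.*2))); first by rewrite ler_wpM2l// ltW.
  rewrite expr_div_n rM (_ : M * _ = - (c * x ^+ k.*2)); last by field; rewrite gt_eqF.
  suff : x ^+ 2 - 1 <= x ^+ k.*2 by nra.
  rewrite -mul2n exprM; have := sqr_ge0 x; set z := x ^+ 2 => z0.
  have [z1|z1] := leP 1 z.
    by apply: le_trans (ler_eXnr k0 z1); lra.
  by apply: (@le_trans _ _ 0); [lra|exact: exprn_ge0].
apply: (@le_trans _ _ (M * - (c * (x / r) ^+ 2))); first by rewrite ler_wpM2l// ltW.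
have Mr : 1 <= M / r ^+ 2.
  rewrite ler_pdivlMr ?exprn_gt0// mul1r -rM; apply: ler_weXn2l => //.
  by rewrite -[2%N]/(1.*2) leq_double.
rewrite expr_div_n (_ : M * _ = - (c * x ^+ 2 * (M / r ^+ 2))); last by field; rewrite gt_eqF.
have : 0 <= c * x ^+ 2 by rewrite mulr_ge0 ?sqr_ge0 ?(ltW c0).
by nra.
Qed.

Lemma scaled_limit (g : R -> R) (m : nat) (L : R) (r : nat -> R) :
  (forall n, 1 <= r n) -> (forall n, r n ^+ m = n.+1%:R) ->
  (forall B, \forall n \near \oo, B < r n) ->
  (forall e, 0 < e -> exists2 d, 0 < d & forall u, `|u| < d ->
     `|g u - L * u ^+ m| <= e * `|u| ^+ m) ->
  forall x, (fun n : nat => n.+1%:R * g (x / r n)) @ \oo --> L * x ^+ m.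
Proof.
move=> r1 rm rB H x; apply/cvgrPdist_le => e e0.
pose e' := e / (1 + `|x| ^+ m).
have x0 : 0 < 1 + `|x| ^+ m by rewrite ltr_pwDl ?exprn_ge0.
have e'0 : 0 < e' by rewrite divr_gt0.
have [d d0 Hd] := H e' e'0.
have cancel (M a b : R) : M != 0 -> M * (a * (b / M)) = a * b by move=> M0; field.
near=> n; have rn0 : 0 < r n by apply: lt_le_trans (r1 n).
have ud : `|x / r n| < d.
  rewrite normrM [X in _ * X]gtr0_norm ?invr_gt0// ltr_pdivrMr// mulrC -ltr_pdivrMr//.
  by near: n; exact: rB.
have := Hd _ ud; rewrite normrM normfV (gtr0_norm rn0) !expr_div_n rm => h.
rewrite distrC.
rewrite (_ : n.+1%:R * g (x / r n) - L * x ^+ m =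
   n.+1%:R * (g (x / r n) - L * (x ^+ m / n.+1%:R))); last first.
  by rewrite mulrBr; congr (_ - _); rewrite cancel // pnatr_eq0.
rewrite normrM ger0_norm//.
apply: (@le_trans _ _ (n.+1%:R * (e' * (`|x| ^+ m / n.+1%:R)))); first by rewrite ler_wpM2l.
rewrite cancel ?pnatr_eq0//.
rewrite /e' mulrAC ler_pdivrMr// ler_wpM2l ?(ltW e0)// lerDr//.
Unshelve. all: by end_near. Qed.

Lemma decay_integrable (w phi : R -> R) (c : R) : 0 < c ->
  measurable_fun setT w -> (forall x, 0 <= w x) ->
  (forall x, w x <= expR (c - c * x ^+ 2)) ->
  quadratic_growth phi ->
  lebesgue_measure.-integrable setT (fun x => (phi x * w x)%:E).
Proof.
move=> c0 mw w0 wc [cphi [C HC]].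
have c20 : 0 < 2 * c by rewrite mulr_gt0.
have i : lebesgue_measure.-integrable setT
    (fun x => (C * expR c * ((1 + x ^+ 2) * gauss (2 * c) x))%:E).
  exact: (integrableZl measurableT (C * expR c) (integrable_gauss_sqr _ c20)).
apply: le_integrable i => //.
  apply/measurable_EFinP; apply: measurable_mulE => //.
  exact: continuous_measurable_fun.
move=> x _; rewrite /= lee_fin; apply: le_trans (ler_norm _).
rewrite normrM (ger0_norm (w0 x)).
rewrite (_ : C * expR c * _ = C * (1 + x ^+ 2) * expR (c - c * x ^+ 2)).
  by apply: ler_pM => //; exact: HC.
rewrite expRD /gauss (_ : - (2 * c * x ^+ 2 / 2) = - (c * x ^+ 2)); last by field.
by ring.
Qed.

(** Dominated convergence: the majorant is a quadratic function times
    [gauss (2 c) x = exp (- c x^2)], the same for all [n]. *)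
Lemma laplace_cvg (w : nat -> R -> R) (v phi : R -> R) (c : R) : 0 < c ->
  (forall n, continuous (w n)) -> (forall n x, w n x <= c - c * x ^+ 2) ->
  (forall x, (fun n => w n x) @ \oo --> v x) -> continuous v ->
  quadratic_growth phi ->
  (fun n => Rintegral lebesgue_measure setT (fun x => phi x * expR (w n x)))
    @ \oo -->
  Rintegral lebesgue_measure setT (fun x => phi x * expR (v x)).
Proof.
move=> c0 cw wc wv cv [cphi [C HC]].
have c20 : 0 < 2 * c by rewrite mulr_gt0.
pose G x := C * expR c * ((1 + x ^+ 2) * gauss (2 * c) x).
have iG : lebesgue_measure.-integrable setT (fun x => (G x)%:E).
  exact: (integrableZl measurableT (C * expR c) (integrable_gauss_sqr _ c20)).
have GE x : G x = C * (1 + x ^+ 2) * expR (c - c * x ^+ 2).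
  rewrite expRD /G /gauss (_ : - (2 * c * x ^+ 2 / 2) = - (c * x ^+ 2)); last by field.
  by ring.
pose f_ n x := (phi x * expR (w n x))%:E.
pose f x := (phi x * expR (v x))%:E.
have mf_ n : measurable_fun setT (f_ n).
  apply/measurable_EFinP; apply: continuous_measurable_fun.
  by have := cw n => ?; continuity.
have mf : measurable_fun setT f.
  by apply/measurable_EFinP; apply: continuous_measurable_fun; continuity.
have f_f : {ae lebesgue_measure, forall x : R, setT x -> f_ ^~ x @ \oo --> f x}.
  apply: aeW => x _; apply: cvg_EFin; first by near=> n.
  apply: cvgM; first exact: cvg_cst.
  by apply: (@cvg_comp _ _ _ (fun n => w n x) expR); [exact: wv|exact: continuous_expR].
have f_G : {ae lebesgue_measure, forall x n, setT x -> (`|f_ n x| <= (G x)%:E)%E}.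
  apply: aeW => x n _; rewrite /= lee_fin GE normrM [X in _ * X]ger0_norm ?expR_ge0//.
  by apply: ler_pM; rewrite ?normr_ge0 ?expR_ge0 ?ler_expR.
have [if_ _ cvg] :=
  @dominated_convergence _ (measurableTypeR R) R lebesgue_measure setT
    measurableT f_ f (EFin \o G) mf_ mf f_f iG f_G.
apply: fine_cvg; rewrite fineK//.
exact: (integrable_fin_num measurableT if_).
Unshelve. all: by end_near. Qed.

End laplace.

(** * The tilted law of the rescaled magnetization *)

Lemma H_N_sum {R : realType} (J h : R) (N : nat) (sigma : nat -> R) :
  - H_N J h N sigma =
  J * S_N N sigma ^+ 2 / (2 * N%:R) + h * S_N N sigma.
Proof.
rewrite /H_N (_ : \sum_(i < N) \sum_(j < N) sigma i * sigma j = S_N N sigma ^+ 2).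
  by rewrite /S_N; ring.
rewrite expr2 /S_N mulr_suml; apply: eq_bigr => i _.
by rewrite mulr_sumr.
Qed.

Section tilted_law.
Context {R : realType} (rho : probability R R) (J h : R).
Hypothesis Hint : forall a b : R, 0 < a ->
  rho.-integrable setT (fun x => (expR (a * x ^+ 2 / 2 + b * x))%:E).
Hypothesis HJ : 0 < J.
Context (P : probability R R) (N : nat) (mu r : R).
Hypothesis iP : forall A : R, 0 < A ->
  P.-integrable setT (fun s => (expR (A * s ^+ 2))%:E).
Hypothesis mP : forall y, (\int[P]_s (expR (s * y))%:E = (mgf rho y ^+ N)%:E)%E.
Hypothesis eP : forall (G : R -> R) (C A : R), measurable_fun setT G -> 0 < A ->
  (forall s, `|G s| <= C * expR (A * s ^+ 2)) ->
  prod_int rho N (fun s => G (S_N N s)) = Rintegral P setT G.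
Hypothesis N0 : (0 < N)%N.
Hypothesis r0 : 0 < r.

Definition weight (s : R) : R := expR (J * s ^+ 2 / (2 * N%:R) + h * s).

Definition rescaled (s : R) : R := r * (s / N%:R - mu).

(** The mean of [G (Sbar)] under [P_N], written over the law [P] of the unweighted sum: [weight] is
    [exp (- H_N)] as a function of the sum. *)
Definition tilted (G : R -> R) : R :=
  Rintegral P setT (fun s => G (rescaled s) * weight s) /
  Rintegral P setT weight.

(** Crude constants: [1 + rescaled^2] costs a factor [exp (s^2)], and the weight costs
    [exp ((J/2 + 1/2) s^2)] through [h s <= h^2/2 + s^2/2]. They depend on [r] and serve
    integrability at fixed [N], not uniformity. *)
Let K := (1 + 2 * r ^+ 2 * (1 + mu ^+ 2)) * expR (h ^+ 2 / 2).
Let A := J / 2 + 3 / 2.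

Lemma tilted_bound (phi : R -> R) (C : R) : 0 <= C ->
  (forall x, `|phi x| <= C * (1 + x ^+ 2)) ->
  forall s, `|phi (rescaled s) * weight s| <= C * K * expR (A * s ^+ 2).
Proof.
move=> C0 HC s; rewrite normrM [X in _ * X]ger0_norm ?expR_ge0//.
have N1 : 1 <= N%:R :> R by rewrite ler1n.
have wle : weight s <= expR (h ^+ 2 / 2) * expR ((J / 2 + 1 / 2) * s ^+ 2).
  rewrite -expRD ler_expR.
  have h1 : J * s ^+ 2 / (2 * N%:R) <= J * s ^+ 2 / 2.
    apply: ler_wpM2l; first by rewrite mulr_ge0 ?sqr_ge0 ?(ltW HJ).
    by rewrite lef_pV2 ?posrE ?mulr_gt0 ?ltr0n// ler_peMr.
  apply: le_trans (lerD h1 (lexx _)) _.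
  have := sqr_ge0 (h - s) => h2.
  rewrite -subr_ge0 (_ : _ - _ = (h - s) ^+ 2 / 2); last by field.
  by rewrite divr_ge0.
have Xle : 1 + rescaled s ^+ 2 <= (1 + 2 * r ^+ 2 * (1 + mu ^+ 2)) * expR (s ^+ 2).
  apply: (@le_trans _ _ ((1 + 2 * r ^+ 2 * (1 + mu ^+ 2)) * (1 + s ^+ 2))).
    rewrite /rescaled exprMn.
    have sN : (s / N%:R) ^+ 2 <= s ^+ 2.
      rewrite expr_div_n ler_pdivrMr ?exprn_gt0 ?ltr0n// ler_peMr ?sqr_ge0//.
      by rewrite exprn_ege1.
    have r2 : 0 <= r ^+ 2 by exact: sqr_ge0.
    have h2 : (s / N%:R - mu) ^+ 2 <= 2 * (1 + mu ^+ 2) * (1 + s ^+ 2).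
      have := sqr_ge0 (s / N%:R + mu); rewrite sqrrB sqrrD.
      have := mulr_ge0 (sqr_ge0 mu) (sqr_ge0 s); have := sqr_ge0 s; have := sqr_ge0 mu.
      nra.
    have : r ^+ 2 * (s / N%:R - mu) ^+ 2 <= r ^+ 2 * (2 * (1 + mu ^+ 2) * (1 + s ^+ 2)).
      by rewrite ler_wpM2l.
    by have := sqr_ge0 s; lra.
  apply: ler_wpM2l; last exact: expR_ge1Dx.
  by apply: addr_ge0 => //; apply: mulr_ge0; [apply: mulr_ge0|apply: addr_ge0];
    rewrite ?sqr_ge0.
apply: (@le_trans _ _ ((C * ((1 + 2 * r ^+ 2 * (1 + mu ^+ 2)) * expR (s ^+ 2))) *
    (expR (h ^+ 2 / 2) * expR ((J / 2 + 1 / 2) * s ^+ 2)))).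
  apply: ler_pM; rewrite ?normr_ge0 ?expR_ge0//.
  by apply: le_trans (HC _) _; rewrite ler_wpM2l.
rewrite /K (_ : A * s ^+ 2 = s ^+ 2 + (J / 2 + 1 / 2) * s ^+ 2); last by rewrite /A; field.
by rewrite expRD le_eqVlt; apply/orP; left; apply/eqP; ring.
Qed.

Lemma A_gt0 : 0 < A. Proof. by rewrite addr_gt0 ?divr_gt0. Qed.

Lemma continuous_rescaled : continuous rescaled.
Proof. by rewrite /rescaled; continuity. Qed.

Lemma continuous_weight : continuous weight.
Proof. by rewrite /weight; continuity. Qed.

Lemma continuous_tilted (phi : R -> R) : continuous phi ->
  continuous (fun s => phi (rescaled s) * weight s).
Proof.
move=> cphi; apply: continuous_mulE; last exact: continuous_weight.
exact: continuous_compE cphi continuous_rescaled.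
Qed.

Lemma quadratic_growth_ge0 (phi : R -> R) : quadratic_growth phi ->
  exists2 C, 0 <= C & forall x, `|phi x| <= C * (1 + x ^+ 2).
Proof.
move=> [_ [C HC]]; exists `|C| => // x; apply: le_trans (HC x) _.
by rewrite ler_wpM2r ?ler_norm// addr_ge0// sqr_ge0.
Qed.

Lemma integrable_tilted (phi : R -> R) : quadratic_growth phi ->
  P.-integrable setT (fun s => (phi (rescaled s) * weight s)%:E).
Proof.
move=> qphi; have [C C0 HC] := quadratic_growth_ge0 phi qphi.
have i := integrableZl measurableT (C * K) (iP A A_gt0).
apply: le_integrable i => //.
  apply/measurable_EFinP; apply: continuous_measurable_fun.
  by apply: continuous_tilted; case: qphi.
move=> s _; rewrite -EFinM/= lee_fin; apply: le_trans (ler_norm _).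
exact: tilted_bound.
Qed.

Let q1 : quadratic_growth (fun=> 1 : R).
Proof.
by apply: (@quadratic_growth_bounded _ _ 1) => [|x]; [continuity|rewrite normr1].
Qed.

Lemma integrable_weight : P.-integrable setT (fun s => (weight s)%:E).
Proof. by have := integrable_tilted _ q1; under eq_fun do rewrite mul1r. Qed.

Lemma weight_mass_gt0 : 0 < Rintegral P setT weight.
Proof.
apply: fine_gt0; rewrite ltey_eq (integrable_fin_num measurableT integrable_weight) andbT.
apply: integral_gt0; first by rewrite [X in X != _]probability_setT.
  by apply: continuous_measurable_fun; exact: continuous_weight.
by move=> x; exact: expR_gt0.
Qed.

Lemma expectation_tilted : expectation tilted.
Proof.
apply: expectation_weighted.
- by apply: continuous_measurable_fun; exact: continuous_rescaled.
- by apply: continuous_measurable_fun; exact: continuous_weight.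
- by move=> x; exact: expR_ge0.
- apply: (integrable_tilted (fun x => 1 + x ^+ 2)).
  split; first by continuity.
  by exists 1 => x; rewrite mul1r ger0_norm// addr_ge0// sqr_ge0.
- by rewrite gt_eqF// weight_mass_gt0.
Qed.

Lemma E_PN_tilted (phi : R -> R) (X : (nat -> R) -> R) : quadratic_growth phi ->
  (forall sigma, X sigma = rescaled (S_N N sigma)) ->
  E_PN rho J h N (fun sigma => phi (X sigma)) = tilted phi.
Proof.
move=> qphi XE; have [C C0 HC] := quadratic_growth_ge0 phi qphi.
have num F : quadratic_growth F ->
    prod_int rho N (fun sigma => F (rescaled (S_N N sigma)) * expR (- H_N J h N sigma)) =
    Rintegral P setT (fun s => F (rescaled s) * weight s).
  move=> qF; have [D D0 HD] := quadratic_growth_ge0 F qF.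
  rewrite -(eP (fun s => F (rescaled s) * weight s) (D * K) A).
  - by congr prod_int; apply/funext => sigma; rewrite H_N_sum.
  - apply: continuous_measurable_fun; apply: continuous_tilted.
    by case: qF.
  - exact: A_gt0.
  - exact: tilted_bound.
rewrite /E_PN /tilted /Z_N; congr (_ / _).
  by rewrite -num//; congr prod_int; apply/funext => sigma; rewrite XE.
have := num _ q1.
under [X in _ = Rintegral _ _ X -> _]eq_fun do rewrite mul1r.
move=> <-; congr prod_int; apply/funext => sigma.
by rewrite mul1r.
Qed.

Let f := f_CW rho J h.
Let a := J * N%:R / r ^+ 2.
Context (c : R).
Hypothesis c0 : 0 < c.
Hypothesis cf : continuous f.
Hypothesis decay : forall x, N%:R * (f (mu + x / r) - f mu) <= c - c * x ^+ 2.

Definition laplace_integral (phi : R -> R) : R := Rintegral lebesgue_measure setT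
  (fun x : R => phi x * expR (N%:R * (f (mu + x / r) - f mu))).

Let B := expR (N%:R * f mu).

Lemma tilted_rate_gt0 : 0 < a.
Proof. by rewrite divr_gt0 ?mulr_gt0 ?ltr0n// exprn_gt0. Qed.

Lemma continuous_laplace_weight :
  continuous (fun x : R => expR (N%:R * (f (mu + x / r) - f mu))).
Proof.
have cfc : continuous (fun x : R => f (mu + x / r)).
  by apply: continuous_compE cf _; continuity.
by continuity.
Qed.

Lemma integrable_laplace (phi : R -> R) : quadratic_growth phi ->
  lebesgue_measure.-integrable setT
    (fun x => (phi x * expR (N%:R * (f (mu + x / r) - f mu)))%:E).
Proof.
apply: (decay_integrable (fun x : R => expR (N%:R * (f (mu + x / r) - f mu))) phi c c0).
- by apply: continuous_measurable_fun; exact: continuous_laplace_weight.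
- by move=> x; exact: expR_ge0.
- by move=> x; rewrite ler_expR.
Qed.

Lemma integral_laplace (phi : R -> R) : quadratic_growth phi ->
  (forall x, 0 <= phi x) ->
  (\int[lebesgue_measure]_x (phi x * expR (N%:R * f (mu + x / r)))%:E =
   (B * laplace_integral phi)%:E)%E.
Proof.
move=> qphi phi0; rewrite EFinM /laplace_integral /Rintegral fineK; last first.
  exact: (integrable_fin_num measurableT (integrable_laplace phi qphi)).
rewrite -ge0_integralZE.
- apply: eq_integral => x _; congr EFin; rewrite /B mulrCA -expRD.
  by congr (_ * expR _); rewrite -mulrDr subrKC.
- apply: continuous_measurable_fun; apply: continuous_mulE; first by case: qphi.
  exact: continuous_laplace_weight.
- by move=> x; rewrite mulr_ge0// expR_ge0.
- exact: expR_ge0.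
Qed.

(** Here [I] is the Gaussian convolution of [phi], known in closed form for the three choices [1],
    [1 + cos] and [x^2]. *)
Lemma tilted_smoothed (phi I : R -> R) : quadratic_growth phi ->
  (forall x, 0 <= phi x) -> quadratic_growth I ->
  (forall s, (\int[lebesgue_measure]_x (phi x * gauss a (x - s))%:E = (I s)%:E)%E) ->
  Rintegral P setT (fun s => I (rescaled s) * weight s) = B * laplace_integral phi.
Proof.
move=> qphi phi0 qI HI; have cphi : continuous phi by case: qphi.
have := integral_gauss_weight rho J h Hint P N mu r phi mP N0 r0 cphi phi0.
rewrite (integral_laplace phi qphi phi0) => /(congr1 fine)/= <-.
rewrite /Rintegral.
congr fine; apply: eq_integral => s _.
by rewrite [X in (X * _)%E](HI (rescaled s)) -EFinM.
Qed.

Lemma tilted_mass :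
  gauss_mass a * Rintegral P setT weight = B * laplace_integral (fun=> 1).
Proof.
rewrite -(@tilted_smoothed (fun=> 1) (fun=> gauss_mass a)) //.
- rewrite -RintegralZl//; exact: integrable_weight.
- by have := quadratic_growth_lin (gauss_mass a - 1) _ _ q1 q1; congr quadratic_growth; apply/funext => x; ring.
- move=> s; under eq_integral do rewrite mul1r.
  by rewrite integral_gauss_centered// tilted_rate_gt0.
Qed.

Lemma laplace_mass_gt0 : 0 < laplace_integral (fun=> 1).
Proof.
have : 0 < B * laplace_integral (fun=> 1).
  by rewrite -tilted_mass mulr_gt0 ?gauss_mass_gt0 ?tilted_rate_gt0 ?weight_mass_gt0.
by rewrite pmulr_rgt0// expR_gt0.
Qed.

(** Smoothing identity for [1 + cos], minus the one for 1, divided by the latter: the factor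
    [exp (N f mu)] cancels. *)
Lemma tilted_cos (t c' : R) :
  gauss_chf a t * tilted (fun x => cos (t * x + c')) =
  laplace_integral (fun x => cos (t * x + c')) / laplace_integral (fun=> 1).
Proof.
have a0 := tilted_rate_gt0; have m0 := gauss_mass_gt0 a a0.
have qc := quadratic_growth_cos t c'.
have qc1 : quadratic_growth (fun x => 1 + cos (t * x + c')).
  have := quadratic_growth_lin 1 _ _ q1 qc.
  by congr quadratic_growth; apply/funext => x; rewrite mulr1.
have qI : quadratic_growth (fun s => gauss_mass a + cos (t * s + c') * gauss_cos a t).
  have := quadratic_growth_lin (gauss_mass a) _ _ q1 (quadratic_growth_lin (gauss_cos a t - 1) _ _ qc qc).
  by congr quadratic_growth; apply/funext => x; ring.
have c10 x : 0 <= 1 + cos (t * x + c') by rewrite -lerBlDl sub0r cos_geN1.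
have := tilted_smoothed (fun x => 1 + cos (t * x + c')) _ qc1 c10 qI
  (fun s => integral_cos_gauss a s t c' a0).
pose W := Rintegral P setT (fun s => cos (t * rescaled s + c') * weight s).
have -> : Rintegral P setT (fun s => (gauss_mass a + cos (t * rescaled s + c') *
    gauss_cos a t) * weight s) =
    gauss_mass a * Rintegral P setT weight + gauss_cos a t * W.
  have iw : P.-integrable setT (fun s => (gauss_mass a * weight s)%:E).
    exact: (integrableZl measurableT (gauss_mass a) integrable_weight).
  have ic : P.-integrable setT (fun s => (gauss_cos a t * (cos (t * rescaled s + c') * weight s))%:E).
    exact: (integrableZl measurableT (gauss_cos a t) (integrable_tilted _ qc)).
  transitivity (Rintegral P setT (fun s => gauss_mass a * weight s +
      gauss_cos a t * (cos (t * rescaled s + c') * weight s))).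
    apply: eq_Rintegral => s _. by rewrite mulrDl; congr (_ + _); ring.
  rewrite RintegralD// RintegralZl//; last exact: integrable_weight.
  by rewrite RintegralZl//; exact: integrable_tilted qc.
have -> : laplace_integral (fun x => 1 + cos (t * x + c')) =
    laplace_integral (fun=> 1) + laplace_integral (fun x => cos (t * x + c')).
  rewrite /laplace_integral -RintegralD//; [|exact: integrable_laplace q1|exact: integrable_laplace qc].
  by apply: eq_Rintegral => x _; rewrite mulrDl.
rewrite tilted_mass mulrDr => /addrI E.
have l0 := laplace_mass_gt0; have B0 : 0 < B by exact: expR_gt0.
have w0 := weight_mass_gt0; have M := tilted_mass.
rewrite /gauss_chf /tilted -/W.
rewrite mulrACA E -invfM [X in _ / X]M invfM mulrACA divff ?mul1r ?gt_eqF//.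
Qed.

(** Smoothing adds the nonnegative variance of the Gaussian; tightness needs only the inequality
    left after dropping it. *)
Lemma tilted_sqr : tilted (fun x => x ^+ 2) <=
  laplace_integral (fun x => x ^+ 2) / laplace_integral (fun=> 1).
Proof.
have a0 := tilted_rate_gt0; have m0 := gauss_mass_gt0 a a0.
have qs := @quadratic_growth_sqr R.
have l0 := laplace_mass_gt0; have B0 : 0 < B by exact: expR_gt0.
have w0 := weight_mass_gt0; have M := tilted_mass.
have s0 (x : R) : 0 <= x ^+ 2 by exact: sqr_ge0.
suff H : gauss_mass a * Rintegral P setT (fun s => rescaled s ^+ 2 * weight s) <=
    B * laplace_integral (fun x => x ^+ 2).
  rewrite /tilted ler_pdivrMr// mulrAC ler_pdivlMr// -(ler_pM2l m0) mulrA.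
  apply: le_trans (ler_wpM2r (ltW l0) H) _.
  by rewrite mulrAC -M -mulrA [_ * laplace_integral _]mulrC.
have v0 := gauss_sqr_ge0 a.
have qI : quadratic_growth (fun s => s ^+ 2 * gauss_mass a + gauss_sqr a).
  have := quadratic_growth_lin (gauss_mass a) _ _ qs (quadratic_growth_lin (gauss_sqr a - 1) _ _ q1 q1).
  by congr quadratic_growth; apply/funext => x; ring.
rewrite -(tilted_smoothed _ _ qs s0 qI (fun s => integral_sqr_gauss a s a0)).
rewrite -RintegralZl//; last exact: integrable_tilted qs.
apply: le_Rintegral => //.
- exact: (integrableZl measurableT (gauss_mass a) (integrable_tilted _ qs)).
- exact: integrable_tilted qI.
move=> s _; rewrite mulrA; apply: ler_wpM2r; first exact: expR_ge0.
by rewrite [gauss_mass a * _]mulrC lerDl.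
Qed.

End tilted_law.

(** * The limit theorem *)

Lemma integral_cos_phase {R : realType} (a t c : R) : 0 < a ->
  Rintegral lebesgue_measure setT (fun x => cos (t * x + c) * gauss a x) =
  cos c * gauss_cos a t.
Proof.
move=> a0; have i1 := integrable_gauss a a0.
have i2 : lebesgue_measure.-integrable setT (fun x => (cos (t * x + c) * gauss a x)%:E).
  apply: (integrable_gauss_bounded a (fun x => cos (t * x + c))) => //; first by continuity.
  move=> x; apply: (@le_trans _ _ 1); last by rewrite lerDl sqr_ge0.
  by rewrite ler_norml cos_geN1 cos_le1.
have := integral_cos_gauss a 0 t c a0; rewrite mulr0 add0r => /(congr1 fine)/= E.
have : Rintegral lebesgue_measure setT (fun x => gauss a x + cos (t * x + c) * gauss a x) =
    gauss_mass a + cos c * gauss_cos a t.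
  rewrite -E; congr fine; apply: eq_integral => x _.
  by rewrite subr0; congr EFin; ring.
rewrite RintegralD// {1}/Rintegral integral_gauss//=.
by move/addrI.
Qed.

Lemma gauss_chf_le1 {R : realType} (a t : R) : 0 < a -> gauss_chf a t <= 1.
Proof.
move=> a0; rewrite /gauss_chf ler_pdivrMr ?gauss_mass_gt0// mul1r.
have -> : gauss_mass a = Rintegral lebesgue_measure setT (gauss a).
  by rewrite /Rintegral integral_gauss.
apply: le_Rintegral => //.
- apply: (integrable_gauss_bounded a (fun x => cos (t * x))) => //; first by continuity.
  exact: normr_cos_le.
- exact: integrable_gauss.
- by move=> x _; rewrite -[leRHS]mul1r ler_wpM2r ?expR_ge0// cos_le1.
Qed.

(** The scale [r] at [N = n + 1]; the shift ensures [N > 0] and [r >= 1] at every index. *)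
Definition scale {R : realType} (k n : nat) : R := n.+1%:R `^ ((k.*2)%:R^-1).

Section curie_weiss.
Context {R : realType} (rho : probability R R) (J h : R).
Hypothesis Hint : forall a b : R, 0 < a ->
  rho.-integrable setT (fun x => (expR (a * x ^+ 2 / 2 + b * x))%:E).
Hypothesis HJ : 0 < J.
Context (mu lambda : R) (k : nat).
Hypothesis Hmax : forall x : R, x != mu -> f_CW rho J h x < f_CW rho J h mu.
Hypothesis Hk : (0 < k)%N.
Hypothesis Hder0 : forall j : nat, (1 <= j <= k.*2.-1)%N ->
  derive1n j (f_CW rho J h) mu = 0.
Hypothesis Hder : derive1n k.*2 (f_CW rho J h) mu = lambda.
Hypothesis Hlam : lambda < 0.

Let f := f_CW rho J h.
Let g u := f (mu + u) - f mu.
Let L := lambda / (k.*2)`!%:R.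

Lemma continuous_f_CW : continuous f.
Proof.
exact: (is_derive_continuous f (f_CW_derive rho J h) (is_derive_f_CW rho Hint J h)).
Qed.

Lemma strength_lt0 : L < 0.
Proof. by rewrite /L pmulr_llt0// invr_gt0 ltr0n fact_gt0. Qed.

Lemma f_CW_peano e : 0 < e -> exists2 d, 0 < d & forall u, `|u| < d ->
  `|g u - L * u ^+ k.*2| <= e * `|u| ^+ k.*2.
Proof.
move=> e0; have m1 : k.*2.-1.+1 = k.*2 by rewrite prednK// double_gt0.
have [d d0 Hd] := peano_taylor f mu k.*2.-1 (smooth_f_CW rho J h Hint) Hder0 e e0.
by exists d => // u /Hd; rewrite m1 /f Hder.
Qed.

Lemma f_CW_decay : exists2 c, 0 < c &
  forall u, g u <= - (c * u ^+ k.*2) \/ g u <= - (c * u ^+ 2).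
Proof.
have [C HC] := f_CW_growth rho J h Hint HJ.
have eta0 : 0 < - L / 2 by rewrite divr_gt0// oppr_gt0 strength_lt0.
have [d d0 Hd] := f_CW_peano (- L / 2) eta0.
have cg : continuous g.
  apply: continuous_addE; last by continuity.
  by apply: (continuous_compE (fun u => mu + u) f continuous_f_CW); continuity.
apply: (global_decay g k (C - f mu + J * mu ^+ 2 / 4) (J / 8) d (- L / 2)) => //.
- by move=> u u0; rewrite subr_lt0; apply: Hmax; rewrite -subr_eq0 addrAC subrr add0r.
- by rewrite divr_gt0.
(* Recentring at [mu] halves the rate [J / 4], by [(mu + u)^2 >= u^2 / 2 - mu^2]. *)
- move=> u; have := HC (mu + u); rewrite -/f /g => H.
  have h2 : 0 <= J * (2 * mu + u) ^+ 2 by rewrite mulr_ge0 ?sqr_ge0 ?(ltW HJ).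
  have E : J * (mu + u) ^+ 2 / 4 = J / 8 * u ^+ 2 - J * mu ^+ 2 / 4 + J * (2 * mu + u) ^+ 2 / 8.
    by field.
  rewrite E in H; move: (f (mu + u)) (f mu) (J * (2 * mu + u) ^+ 2) H h2 => F F0 T.
  by lra.
- move=> u /Hd; rewrite ler_norml => /andP[_].
  have -> : `|u| ^+ k.*2 = u ^+ k.*2.
    by rewrite -normrX ger0_norm// pow_even_ge0.
  by move: (u ^+ k.*2) (g u) => T G; lra.
Qed.

Let r := @scale R k.

Lemma scale_ge1 n : 1 <= r n.
Proof.
have -> : 1 = 1 `^ ((k.*2)%:R^-1) :> R by rewrite powR1.
by rewrite /r /scale; apply: ge0_ler_powR; rewrite ?invr_ge0 ?nnegrE ?ler1n.
Qed.

Lemma scale_pow n : r n ^+ k.*2 = n.+1%:R.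
Proof.
rewrite /r /scale -powR_mulrn ?powR_ge0// -powRrM mulVf ?powRr1//.
by rewrite pnatr_eq0 -lt0n double_gt0.
Qed.

Lemma scale_cvgy B : \forall n \near \oo, B < r n.
Proof.
near=> n; rewrite ltNge; apply/negP => rB.
have r0 : 0 <= r n by apply: le_trans (scale_ge1 n).
have B0 : 0 <= B by apply: le_trans rB.
have : r n ^+ k.*2 <= B ^+ k.*2 by rewrite lerXn2r ?nnegrE.
apply/negP; rewrite -ltNge scale_pow.
apply: (@lt_le_trans _ _ (Num.truncn (B ^+ k.*2)).+1%:R); first exact: truncnS_gt.
rewrite ler_nat ltnS; near: n; exact: nbhs_infty_ge.
Unshelve. all: by end_near. Qed.

Lemma Sbar_rescaled n sigma :
  Sbar mu k n.+1 sigma = rescaled n.+1 mu (r n) (S_N n.+1 sigma).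
Proof.
have n0 : n.+1%:R != 0 :> R by rewrite pnatr_eq0.
rewrite /Sbar /rescaled powRB ?n0 ?implybT// powRr1// -/(scale k n) -/(r n) invf_div.
have : r n != 0 by rewrite gt_eqF// (lt_le_trans _ (scale_ge1 n)).
by move: (r n) (n.+1%:R) n0 => ? M M0 ?; field; rewrite M0.
Qed.

Let limit_weight (x : R) := expR (L * x ^+ k.*2).

Lemma limit_weight_decay (x : R) : L * x ^+ k.*2 <= - L - - L * x ^+ 2.
Proof.
have L0 : 0 < - L by rewrite oppr_gt0 strength_lt0.
have := scaled_decay (fun u => L * u ^+ k.*2) k (- L) 1 1 Hk L0 (lexx 1) (expr1n _ _).
move=> /(_ _ x); rewrite divr1 mul1r; apply => u; left.
by rewrite mulNr opprK.
Qed.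

Lemma continuous_limit_weight : continuous limit_weight.
Proof. by rewrite /limit_weight; continuity. Qed.

Lemma integrable_limit_weight (phi : R -> R) : quadratic_growth phi ->
  lebesgue_measure.-integrable setT (fun x => (phi x * limit_weight x)%:E).
Proof.
apply: (decay_integrable limit_weight phi (- L)).
- by rewrite oppr_gt0 strength_lt0.
- by apply: continuous_measurable_fun; exact: continuous_limit_weight.
- by move=> x; exact: expR_ge0.
- by move=> x; rewrite ler_expR limit_weight_decay.
Qed.

Lemma limit_mass_gt0 : 0 < Rintegral lebesgue_measure setT limit_weight.
Proof.
have q1 : quadratic_growth (fun=> 1 : R).
  by apply: (@quadratic_growth_bounded _ _ 1) => [|x]; [continuity|rewrite normr1].
have i : lebesgue_measure.-integrable setT (fun x => (limit_weight x)%:E).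
  by have := integrable_limit_weight _ q1; under eq_fun do rewrite mul1r.
apply: fine_gt0; rewrite ltey_eq (integrable_fin_num measurableT i) andbT.
apply: integral_gt0.
- rewrite gt_eqF//; have : (lebesgue_measure (`[0%R, 1%R]%classic : set R) <= lebesgue_measure [set: R])%E.
    by apply: le_measure; rewrite ?inE.
  by rewrite lebesgue_measure_itv/= lte_fin ltr01 oppr0 adde0; apply: lt_le_trans; rewrite lte_fin.
- by apply: continuous_measurable_fun; exact: continuous_limit_weight.
- by move=> x; exact: expR_gt0.
Qed.

(** Treats both cases at once: [kappa] is the limiting factor of the smoothing, [gauss_chf J] for
    [k = 1] and 1 for [k > 1]. The last hypothesis on [E] says that the smoothed limit is the
    Laplace limit. *)
Lemma curie_weiss_cvg (E : (R -> R) -> R) (kappa : R -> R) :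
  expectation E -> (forall t, kappa t != 0) ->
  (forall t, (fun n => gauss_chf (J * n.+1%:R / r n ^+ 2) t) @ \oo --> kappa t) ->
  (forall t c, kappa t * E (fun x => cos (t * x + c)) =
     Rintegral lebesgue_measure setT (fun x => cos (t * x + c) * limit_weight x) /
     Rintegral lebesgue_measure setT limit_weight) ->
  forall (G : R -> R) (M : R), continuous G -> (forall x, `|G x| <= M) ->
  (fun N => E_PN rho J h N (fun sigma => G (Sbar mu k N sigma))) @ \oo --> E G.
Proof.
move=> EE kappa0 Hkappa HE G M cG HM.
have q1 : quadratic_growth (fun=> 1 : R).
  by apply: (@quadratic_growth_bounded _ _ 1) => [|x]; [continuity|rewrite normr1].
pose P n := projT1 (cid (law_of_sum rho Hint n.+1)).
have HP n := projT2 (cid (law_of_sum rho Hint n.+1)).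
have r0 n : 0 < r n by apply: lt_le_trans (scale_ge1 n).
pose E_ n := tilted J h (P n) n.+1 mu (r n).
have EE_ n : expectation (E_ n).
  by have [iP _ _] := HP n; apply: expectation_tilted.
have EP phi : quadratic_growth phi ->
    (fun n => E_PN rho J h n.+1 (fun sigma => phi (Sbar mu k n.+1 sigma))) =
    (fun n => E_ n phi).
  move=> qphi; apply/funext => n; have [_ _ eP] := HP n.
  apply: (E_PN_tilted rho J h HJ (P n) n.+1 mu (r n) eP) => //.
  exact: Sbar_rescaled.
have [c c0 Hc] := f_CW_decay.
have decay n x : n.+1%:R * (f (mu + x / r n) - f mu) <= c - c * x ^+ 2.
  exact: (scaled_decay g k c (r n) n.+1%:R Hk c0 (scale_ge1 n) (scale_pow n) Hc x).
pose A n phi := laplace_integral rho J h n.+1 mu (r n) phi.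
have cvgA phi : quadratic_growth phi -> A ^~ phi @ \oo -->
    Rintegral lebesgue_measure setT (fun x => phi x * limit_weight x).
  move=> qphi; apply: (laplace_cvg (fun n x => n.+1%:R * (f (mu + x / r n) - f mu)) _ _ c) => //.
  - move=> n; apply: continuous_mulE; first by continuity.
    apply: continuous_addE; last by continuity.
    by apply: (continuous_compE (fun x => mu + x / r n) f continuous_f_CW); continuity.
  - move=> x; exact: (scaled_limit g k.*2 L r scale_ge1 scale_pow scale_cvgy f_CW_peano x).
  - by continuity.
have mass := limit_mass_gt0.
have m1 : Rintegral lebesgue_measure setT (fun x => 1 * limit_weight x) =
    Rintegral lebesgue_measure setT limit_weight.
  by apply: eq_Rintegral => x _; rewrite mul1r.
have cvgAA phi : quadratic_growth phi -> (fun n => A n phi / A n (fun=> 1)) @ \oo -->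
    Rintegral lebesgue_measure setT (fun x => phi x * limit_weight x) /
    Rintegral lebesgue_measure setT limit_weight.
  move=> qphi; apply: cvgM; first exact: cvgA.
  by rewrite -m1; apply: cvgV; [rewrite m1 gt_eqF|exact: cvgA].
have Ecos t c' : (fun n => E_ n (fun x => cos (t * x + c'))) @ \oo -->
    E (fun x => cos (t * x + c')).
  have -> : (fun n => E_ n (fun x => cos (t * x + c'))) =
    (fun n => (A n (fun x => cos (t * x + c')) / A n (fun=> 1)) *
              (gauss_chf (J * n.+1%:R / r n ^+ 2) t)^-1).
    apply/funext => n; have [iP mP _] := HP n.
    rewrite -(tilted_cos rho J h Hint HJ (P n) n.+1 mu (r n) iP mP isT (r0 n) c c0 continuous_f_CW (decay n)).
    rewrite mulrC mulrA mulVf ?mul1r//; apply: gauss_chf_neq0.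
    by rewrite divr_gt0 ?mulr_gt0 ?exprn_gt0.
  have -> : E (fun x => cos (t * x + c')) = (kappa t * E (fun x => cos (t * x + c'))) / kappa t.
    by rewrite mulrAC divff ?mul1r.
  rewrite HE; apply: cvgM; first by apply: cvgAA; exact: quadratic_growth_cos.
  by apply: cvgV => //; exact: Hkappa.
have Esqr : \forall n \near \oo, E_ n (fun x => x ^+ 2) <=
    Rintegral lebesgue_measure setT (fun x => x ^+ 2 * limit_weight x) /
    Rintegral lebesgue_measure setT limit_weight + 1.
  have := cvgAA _ (@quadratic_growth_sqr R); move/cvgrPdist_le => /(_ 1 ltr01).
  apply: filterS => n; rewrite ler_distl => /andP[H _]; have [iP mP _] := HP n.
  apply: le_trans (tilted_sqr rho J h Hint HJ (P n) n.+1 mu (r n) iP mP isT (r0 n) c c0 continuous_f_CW (decay n)) _.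
  by rewrite -lerBlDr.
have := expectation_cvg E_ E _ (nearW _ EE_) EE Esqr Ecos G M cG HM.
rewrite -(EP G (quadratic_growth_bounded G M cG HM)) => H.
(* The convergence was shown along [N = n + 1]. *)
by rewrite -cvg_shiftS; exact: H.
Qed.

End curie_weiss.

Lemma gauss_decay {R : realType} (a x : R) : 0 < a ->
  gauss a x <= expR (a / 2 - a / 2 * x ^+ 2).
Proof.
move=> a0; rewrite ler_expR (_ : - (a * x ^+ 2 / 2) = - (a / 2 * x ^+ 2)); last by field.
by rewrite lerDr divr_ge0// ltW.
Qed.

Lemma integrable_gauss_growth {R : realType} (a : R) (phi : R -> R) : 0 < a ->
  quadratic_growth phi ->
  lebesgue_measure.-integrable setT (fun x => (phi x * gauss a x)%:E).
Proof.
move=> a0; apply: (decay_integrable (gauss a) phi (a / 2)).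
- by rewrite divr_gt0.
- exact: measurable_gauss.
- by move=> x; exact: expR_ge0.
- by move=> x; exact: gauss_decay.
Qed.

Lemma Rintegral_gauss {R : realType} (a : R) : 0 < a ->
  Rintegral lebesgue_measure setT (gauss a) = gauss_mass a.
Proof. by move=> a0; rewrite /Rintegral integral_gauss. Qed.

Lemma gauss_chf_cvg1 {R : realType} (a : nat -> R) (t : R) : (forall n, 0 < a n) ->
  (forall B, \forall n \near \oo, B < a n) ->
  (fun n => gauss_chf (a n) t) @ \oo --> (1 : R).
Proof.
move=> a0 aB; apply/cvgrPdist_le => e e0; near=> n.
have le1 := gauss_chf_le1 (a n) t (a0 n).
rewrite ger0_norm ?subr_ge0// lerBlDr -lerBlDl.
apply: le_trans (gauss_chf_ge (a n) t (a0 n)); rewrite lerD2l lerN2.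
rewrite ler_pdivrMr// [leRHS]mulrC -ler_pdivrMr//; apply: ltW.
by near: n; exact: aB.
Unshelve. all: by end_near. Qed.

Theorem theorem2 (R : realType) (rho : probability R R) (J h : R)
  (* rho non-degenerate: not a Dirac mass *)
  (Hnondeg : forall a : R, (rho [set a] < 1)%E)
  (* exponential-quadratic integrability *)
  (Hint : forall a b : R, 0 < a ->
     rho.-integrable setT (fun x => (expR (a * x ^+ 2 / 2 + b * x))%:E))
  (HJ : 0 < J)
  (mu lambda : R) (k : nat)
  (* mu is the unique global maximum point of f *)
  (Hmax : forall x : R, x != mu -> f_CW rho J h x < f_CW rho J h mu)
  (* mu has type k and strength lambda *)
  (Hk : (0 < k)%N)
  (Hder0 : forall j : nat, (1 <= j <= k.*2.-1)%N ->
     derive1n j (f_CW rho J h) mu = 0)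
  (Hder : derive1n k.*2 (f_CW rho J h) mu = lambda)
  (Hlam : lambda < 0) :
  (k = 1%N ->
     0 < (- lambda)^-1 - J^-1 /\
     forall g : R -> R, continuous g -> (exists M : R, forall x, `|g x| <= M) ->
       (fun N : nat => E_PN rho J h N (fun sigma => g (Sbar mu k N sigma)))
         @ \oo -->
       Rintegral lebesgue_measure setT
         (fun x => g x * normal_pdf 0 (Num.sqrt ((- lambda)^-1 - J^-1)) x))
  /\
  ((1 < k)%N ->
     forall g : R -> R, continuous g -> (exists M : R, forall x, `|g x| <= M) ->
       (fun N : nat => E_PN rho J h N (fun sigma => g (Sbar mu k N sigma)))
         @ \oo -->
       Rintegral lebesgue_measure setT
         (fun x => g x * expR (lambda / (k.*2)`!%:R * x ^+ k.*2))
       / Rintegral lebesgue_measure setT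
         (fun x => expR (lambda / (k.*2)`!%:R * x ^+ k.*2))).
Proof.
have q2 : quadratic_growth (fun x : R => 1 + x ^+ 2).
  split; first by continuity.
  by exists 1 => x; rewrite mul1r ger0_norm// addr_ge0// sqr_ge0.
have cvg := curie_weiss_cvg rho J h Hint HJ mu lambda k Hmax Hk Hder0 Hder Hlam.
have mlam : 0 < - lambda by rewrite oppr_gt0.
split=> [k1|k1].
- have Jlam : - lambda < J.
    rewrite ltrNl -Hder k1; exact: derive2_f_CW_gt.
  have v0 : 0 < (- lambda)^-1 - J^-1 by rewrite subr_gt0 ltf_pV2 ?posrE.
  split=> // g cg [M HM].
  (* [v] is the limiting variance and [b] its precision. *)
  set v := (- lambda)^-1 - J^-1 in v0 *; pose b := v^-1.
  have b0 : 0 < b by rewrite invr_gt0.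
  have mb := gauss_mass_gt0 b b0.
  pose E (G : R -> R) := Rintegral lebesgue_measure setT (fun x => G x * gauss b x) /
    Rintegral lebesgue_measure setT (gauss b).
  have -> : Rintegral lebesgue_measure setT
      (fun x => g x * normal_pdf 0 (Num.sqrt v) x) = E g.
    rewrite /E Rintegral_gauss// mulrC -RintegralZl//; last first.
      exact: integrable_gauss_growth (quadratic_growth_bounded g M cg HM).
    apply: eq_Rintegral => x _.
    by rewrite -[v]invrK normal_pdf_gauss// mulrCA.
  have EE : expectation E.
    apply: (expectation_weighted lebesgue_measure (fun x => x) (gauss b)).
    + exact: measurable_id.
    + exact: measurable_gauss.
    + by move=> x; exact: expR_ge0.
    + exact: integrable_gauss_growth b0 q2.
    + by rewrite Rintegral_gauss// gt_eqF.
  have wE x : expR (lambda / (k.*2)`!%:R * x ^+ k.*2) = gauss (- lambda) x.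
    by rewrite k1 /gauss; congr expR; rewrite !mulNr opprK mulrAC.
  apply: (cvg E (gauss_chf J) EE _ _ _ g M cg HM).
  + by move=> t; exact: gauss_chf_neq0.
  (* For [k = 1], [r^2 = N], so the added Gaussian has precision exactly [J]. *)
  + move=> t; rewrite (_ : (fun n => _) = (fun=> gauss_chf J t)); first exact: cvg_cst.
    apply/funext => n; congr (gauss_chf _ t).
    have := scale_pow k Hk n; rewrite {2}k1 => ->.
    by rewrite mulfK// pnatr_eq0.
  + move=> t c.
    under [X in _ = Rintegral _ _ X / _]eq_fun do rewrite wE.
    under [X in _ = _ / Rintegral _ _ X]eq_fun do rewrite wE.
    rewrite /E !integral_cos_phase// !Rintegral_gauss//.
    (* In terms of variances: [1/b + 1/J = 1/(- lambda)]. *)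
    have r : J * b / (J + b) = - lambda.
      rewrite (_ : _ / _ = (b^-1 + J^-1)^-1); last first.
        by field; rewrite !gt_eqF// addr_gt0.
      by rewrite /b invrK /v subrK invrK.
    have C := gauss_chf_conv J b t HJ b0; rewrite r in C.
    transitivity (cos c * (gauss_chf J t * gauss_chf b t)).
      by rewrite -(mulrA (cos c)) mulrCA.
    by rewrite C /gauss_chf mulrA.
- move=> g cg [M HM].
  pose w x := expR (lambda / (k.*2)`!%:R * x ^+ k.*2).
  pose E (G : R -> R) := Rintegral lebesgue_measure setT (fun x => G x * w x) /
    Rintegral lebesgue_measure setT w.
  have EE : expectation E.
    apply: (expectation_weighted lebesgue_measure (fun x => x) w).
    + exact: measurable_id.
    + by apply: continuous_measurable_fun; rewrite /w; continuity.
    + by move=> x; exact: expR_ge0.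
    + exact: (integrable_limit_weight lambda k Hk Hlam (fun x => 1 + x ^+ 2) q2).
    + by rewrite gt_eqF// (limit_mass_gt0 lambda k Hk Hlam).
  apply: (cvg E (fun=> 1) EE _ _ _ g M cg HM).
  + by move=> t; exact: oner_neq0.
  + move=> t; apply: gauss_chf_cvg1.
      move=> n; apply: divr_gt0; first exact: mulr_gt0.
      by rewrite exprn_gt0// (lt_le_trans ltr01 (scale_ge1 k n)).
    (* Since [k > 1] and [r >= 1], [N = r^(2k) >= r^3], so the precision [J N / r^2] is at least
       [J r], which exceeds [B]. *)
    move=> B; have := scale_cvgy k Hk (B / J); apply: filterS => n Br.
    have r1 := scale_ge1 (R := R) k n; have := scale_pow (R := R) k Hk n.
    move: (scale k n) Br r1 => r Br r1 rn.
    have r0 : 0 < r by apply: lt_le_trans r1.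
    rewrite -rn ltr_pdivlMr ?exprn_gt0//.
    move: Br; rewrite ltr_pdivrMr// => Br.
    apply: (@lt_le_trans _ _ (r * J * r ^+ 2)); first by rewrite ltr_pM2r ?exprn_gt0.
    rewrite mulrAC -exprS [r ^+ 3 * _]mulrC ler_wpM2l ?(ltW HJ)//.
    apply: ler_weXn2l => //; rewrite -(ltn_double 1) in k1; exact: k1.
  + by move=> t c; rewrite mul1r.
Qed.
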